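(* Let $k$ be a field of characteristic not $2$, $n$ even, $W$ an $n$-dimensional $k$-vector space, and $H=\mathrm{SL}(W)/\mu_2$ acting on $V=\mathrm{Sym}_2W^*\oplus\mathrm{Sym}_2W^*$ (the central $\mu_2$ of $\mathrm{SL}(W)$ acts trivially since $n$ is even). Let $f(x,y)=f_0x^n+f_1x^{n-1}y+\cdots+f_ny^n$ be a binary form of degree $n$ over $k$ with $\Delta(f)\neq0$ and $f_0\neq0$. Write $f(x,1)=f_0g(x)$ with $g$ monic and let $L=k[x]/(g)$, an étale $k$-algebra of degree $n$ with norm $N:L\to k$. Then there is a bijection between the set of $H(k)$-orbits of vectors $(A,B)\in V(k)$ with invariant binary form $f(x,y)$ and the set of equivalence classes of pairs $(\alpha,t)$ with $\alpha\in L^\times$, $t\in k^\times$, $f_0N(\alpha)=t^2$, where $(\alpha,t)$ is equivalent to $(\alpha^*,t^* )$ if there exist $c\in L^\times$ and $d\in k^\times$ with $c^2d\alpha^*=\alpha$ and $N(c)d^{n/2}t^*=t$. Moreover, the group scheme $H_f$ obtained by descending the stabilizers $H_{A,B}$, $(A,B)\in V_f(k^s)$, to $k$ is the finite abelian group scheme $(\mathrm{Res}_{L/k}\mu_2)_{N=1}/\mu_2$ of order $2^{n-2}$.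
   Context: $\mathrm{Sym}_2W^*$ is the space of symmetric bilinear forms on $W$, with $\mathrm{SL}(W)$ acting by $(g\cdot A)(w,w')=A(gw,gw')$. Fix a basis $e$ of $\wedge^nW$; $\mathrm{disc}(A)=(-1)^{n(n-1)/2}\det(A(w_i,w_j))$ for any basis with $w_1\wedge\cdots\wedge w_n=e$. The invariant binary form of $(A,B)$ is $\mathrm{disc}(xA-yB)$; $V_f$ is the set of vectors with invariant $f$. $\Delta(f)=\prod_{i<j}(\alpha_i\beta_j-\alpha_j\beta_i)^2$ for $f=\prod_i(\alpha_ix-\beta_iy)$ over an algebraic closure. $H_f$ is obtained as follows: $H(k^s)$ acts transitively on $V_f(k^s)$ with abelian stabilizers; for $v\in V_f(k^s)$, $\sigma\in\mathrm{Gal}(k^s/k)$ pick $h_\sigma\in H(k^s)$ with $h_\sigma\,{}^\sigma v=v$; conjugation by $h_\sigma$ gives choice-independent isomorphisms ${}^\sigma(H_v)\to H_v$ which form descent data, and $H_f$ is the descended $k$-group scheme. $(\mathrm{Res}_{L/k}\mu_2)_{N=1}$ is the kernel of the norm $\mathrm{Res}_{L/k}\mu_2\to\mu_2$, and $\mu_2$ is embedded in it diagonally. *)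

(* Defs.v *)
From HB Require Import structures.
From mathcomp Require Import all_boot all_order all_algebra all_field.
From mathcomp Require Import generic_quotient polyXY qpoly.
From mathcomp Require Import boolp classical_sets functions cardinality.

Set Implicit Arguments.
Unset Strict Implicit.
Unset Printing Implicit Defensive.

Import GRing.Theory.
Local Open Scope ring_scope.
Local Open Scope quotient_scope.
Local Open Scope classical_set_scope.

Definition is_separable_closure (k ks : fieldType) (iota : {rmorphism k -> ks}) :=
  (forall x : ks, exists2 p : {poly k},
     separable_poly p & root (map_poly iota p) x) /\
  (forall p : {poly ks}, separable_poly p -> (1 < size p)%N ->
     exists x, root p x).

Definition is_algebraic_closure (k : fieldType) (kbar : closedFieldType)
  (j : {rmorphism k -> kbar}) := forall x : kbar, algebraicOver j x.

Definition is_gal (k ks : fieldType) (iota : {rmorphism k -> ks})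
  (s : {rmorphism ks -> ks}) :=
  bijective s /\ forall x, s (iota x) = iota x.

(* A binary form of degree n is given by its coefficients f_0, ..., f_n, where
   f_i is the coefficient of x^(n-i) y^i. Polynomials in x and y live in
   {poly {poly R}} = R[y][x], with x = 'X and y = 'Y. *)
Definition beval (R : nzRingType) n (f : 'I_n.+1 -> R) (x y : R) : R :=
  \sum_(i < n.+1) f i * x ^+ (n - i) * y ^+ i.

Definition bform (R : nzRingType) n (f : 'I_n.+1 -> R) : {poly {poly R}} :=
  beval (fun i => (f i)%:P%:P) 'X 'Y.

Definition dehom (R : nzRingType) n (f : 'I_n.+1 -> R) : {poly R} :=
  beval (fun i => (f i)%:P) 'X 1.

Definition is_Delta (k K : fieldType) (j : {rmorphism k -> K}) n
  (f : 'I_n.+1 -> k) (D : K) :=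
  exists a b : 'I_n -> K,
    bform (j \o f) =
      \prod_(i < n) ((a i)%:P%:P * 'X - (b i)%:P%:P * 'Y) /\
    D = \prod_(i < n) \prod_(l < n | (i < l)%N) (a i * b l - a l * b i) ^+ 2.

(* W = K^n with e the wedge of the standard basis; a bilinear form is its Gram
   matrix. *)
Definition disc (R : comNzRingType) n (A : 'M[R]_n) : R :=
  (-1) ^+ (n * n.-1)./2 * \det A.

Definition inv_form (R : comNzRingType) n (v : 'M[R]_n * 'M[R]_n) :
    {poly {poly R}} :=
  disc ('X *: map_mx (fun c => c%:P%:P) v.1
        - 'Y *: map_mx (fun c => c%:P%:P) v.2).

Definition V_ (R : comNzRingType) n : set ('M[R]_n * 'M[R]_n) :=
  [set v | v.1^T = v.1 /\ v.2^T = v.2].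

Definition Vf (R : comNzRingType) n (f : 'I_n.+1 -> R) :
    set ('M[R]_n * 'M[R]_n) :=
  [set v | V_ v /\ inv_form v = bform f].

Definition map_V (R S : nzRingType) n (s : R -> S) (v : 'M[R]_n * 'M[R]_n) :=
  (map_mx s v.1, map_mx s v.2).

(* The Gram matrix of (w, w') |-> A (g w, g w'). As a map of g this reverses
   products. *)
Definition act (R : comNzRingType) n (g : 'M[R]_n) (v : 'M[R]_n * 'M[R]_n) :=
  (g^T *m v.1 *m g, g^T *m v.2 *m g).

(* Quotient by mu_2(K) = {1, -1}. *)
Section ModSign.
Variable U : zmodType.

Definition pm_rel : rel U := fun x y => (y == x) || (y == - x).

Fact pm_refl : reflexive pm_rel.
Proof. by move=> x; rewrite /pm_rel eqxx. Qed.

Fact pm_sym : symmetric pm_rel.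
Proof.
by move=> x y; rewrite /pm_rel eq_sym [y == - x]eq_sym eqr_oppLR.
Qed.

Fact pm_trans : transitive pm_rel.
Proof.
move=> y x z /orP[]/eqP-> /orP[]/eqP->; rewrite /pm_rel ?opprK eqxx ?orbT //.
Qed.

Canonical pm_equiv := EquivRel pm_rel pm_refl pm_sym pm_trans.

Definition modpm := {eq_quot pm_rel}.
HB.instance Definition _ := Choice.on modpm.
HB.instance Definition _ := EqQuotient.on modpm.

Lemma pm_piP (x y : U) :
  reflect (y = x \/ y = - x) (\pi_modpm x == \pi_modpm y).
Proof.
rewrite piE /= /pm_rel.
by apply: (iffP orP) => -[H|H]; [left|right|left|right]; apply/eqP.
Qed.

Lemma pm_reprP (x : U) :
  repr (\pi_modpm x) = x \/ repr (\pi_modpm x) = - x.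
Proof. by apply/pm_piP; rewrite reprK. Qed.

End ModSign.

Section SLmodMu2.
Variables (K : fieldType) (n : nat).
Local Notation Q := (modpm 'M[K]_n).

(* For n even, the points of SL(W)/mu_2 over a separably closed field K of
   characteristic not 2: SL_n(K)/mu_2(K), the classes of matrices of
   determinant 1. *)
Definition SLmu2 : set Q := [set \pi_Q g | g in [set g | \det g = 1]].

Definition hmul (x y : Q) : Q := \pi_Q (repr x *m repr y).
Definition hinv (x : Q) : Q := \pi_Q (invmx (repr x)).
Definition hact (x : Q) (v : 'M[K]_n * 'M[K]_n) := act (repr x) v.
Definition hgal (s : {rmorphism K -> K}) (x : Q) : Q :=
  \pi_Q (map_mx s (repr x)).

Definition hstab (v : 'M[K]_n * 'M[K]_n) : set Q :=
  [set x | SLmu2 x /\ hact x v = v].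

(* In characteristic not 2 the isogeny SL(W) -> SL(W)/mu_2 is etale, so this is
   the Lie algebra of the scheme-theoretic stabilizer of v in SL(W)/mu_2. *)
Definition lie_stab (v : 'M[K]_n * 'M[K]_n) : set 'M[K]_n :=
  [set X | [/\ \tr X = 0,
               X^T *m v.1 + v.1 *m X = 0 &
               X^T *m v.2 + v.2 *m X = 0]].

Lemma hmulE (g h : 'M[K]_n) : hmul (\pi_Q g) (\pi_Q h) = \pi_Q (g *m h).
Proof.
apply/eqP/pm_piP.
by case: (pm_reprP g) => ->; case: (pm_reprP h) => ->;
  rewrite ?mulNmx ?mulmxN ?opprK; [left|right|right|left].
Qed.

Lemma hinvE (g : 'M[K]_n) : hinv (\pi_Q g) = \pi_Q (invmx g).
Proof.
apply/eqP/pm_piP; case: (pm_reprP g) => ->; [by left|right].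
have gE : - g = -1 *: g by rewrite scaleN1r.
have [gU|gNU] := boolP (g \in unitmx).
  by rewrite gE invmxZ ?unitmxZ ?unitrN1 // invrN1 scaleN1r opprK.
have gNU' : - g \notin unitmx by rewrite gE unitmxZ ?unitrN1.
by rewrite /invmx (negPf gNU) (negPf gNU') opprK.
Qed.

Lemma hactE (g : 'M[K]_n) v : hact (\pi_Q g) v = act g v.
Proof.
rewrite /hact /act; case: (pm_reprP g) => -> //.
have -> : (- g)^T = - g^T by rewrite raddfN.
by rewrite !mulNmx !mulmxN !opprK.
Qed.

Lemma hgalE s (g : 'M[K]_n) : hgal s (\pi_Q g) = \pi_Q (map_mx s g).
Proof.
apply/eqP/pm_piP.
by case: (pm_reprP g) => ->; [left|right; rewrite map_mxN opprK].
Qed.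

End SLmodMu2.

Arguments SLmu2 K n : clear implicits.

(* The k-points of SL(W)/mu_2: the Galois-invariant points over ks. *)
Definition SLmu2_rat (k ks : fieldType) (iota : {rmorphism k -> ks}) n :
    set (modpm 'M[ks]_n) :=
  [set x | SLmu2 ks n x /\ forall s, is_gal iota s -> hgal s x = x].

Arguments SLmu2_rat {k ks} iota n.

Definition orbit (k ks : fieldType) (iota : {rmorphism k -> ks}) n
    (v : 'M[k]_n * 'M[k]_n) : set ('M[k]_n * 'M[k]_n) :=
  [set w | exists2 h, SLmu2_rat iota n h &
           hact h (map_V iota v) = map_V iota w].

Definition orbits (k ks : fieldType) (iota : {rmorphism k -> ks}) n
    (f : 'I_n.+1 -> k) : set (set ('M[k]_n * 'M[k]_n)) :=
  [set orbit iota v | v in Vf f].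

(* The norm of a is the determinant of multiplication by a on R[x]/(p), here in
   the basis 1, x, ..., x^(deg p - 1). *)
Definition qnorm (R : comNzRingType) (p : {poly R}) (a : {poly %/ p}) : R :=
  \det (\matrix_(i < (size (mk_monic p)).-1, l < (size (mk_monic p)).-1)
          (a * in_qpoly p 'X^i : {poly %/ p})`_l).

Definition pairs (k : fieldType) (g : {poly k}) (f0 : k) :
    set ({poly %/ g} * k) :=
  [set u | [/\ u.1 \is a GRing.unit, u.2 != 0 &
               f0 * qnorm u.1 = u.2 ^+ 2]].

Arguments pairs {k} g f0.

Definition pair_equiv (k : fieldType) (g : {poly k}) n
    (u w : {poly %/ g} * k) :=
  exists (c : {poly %/ g}) (d : k),
    [/\ c \is a GRing.unit, d != 0,
        d *: (c ^+ 2 * w.1) = u.1 &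
        qnorm c * d ^+ n./2 * w.2 = u.2].

Definition pair_classes (k : fieldType) (g : {poly k}) n (f0 : k) :
    set (set ({poly %/ g} * k)) :=
  [set [set w | pairs g f0 w /\ pair_equiv n u w] | u in pairs g f0].

Arguments pair_classes {k} g n f0.

(* The Galois module of ks-points of (Res_{L/k} mu_2)_{N=1} / mu_2, where
   L = k[x]/(g) and p is the image of g over ks, so that L (x)_k ks = ks[x]/(p)
   with the Galois group acting on coefficients. *)
Section ResMu2.
Variables (K : fieldType) (p : {poly K}).
Local Notation LK := {poly %/ p}.
Local Notation Q := (modpm LK).

Definition resmu2N1 : set LK := [set a | a ^+ 2 = 1 /\ qnorm a = 1].
Definition Rmu2 : set Q := [set \pi_Q a | a in resmu2N1].

Definition rmul (x y : Q) : Q := \pi_Q (repr x * repr y).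
Definition rgal (s : {rmorphism K -> K}) (x : Q) : Q :=
  \pi_Q (in_qpoly p (map_poly s (repr x : LK))).

Lemma rmulE (a b : LK) : rmul (\pi_Q a) (\pi_Q b) = \pi_Q (a * b).
Proof.
apply/eqP/pm_piP.
by case: (pm_reprP a) => ->; case: (pm_reprP b) => ->;
  rewrite ?mulNr ?mulrN ?opprK; [left|right|right|left].
Qed.

Lemma rgalE s (a : LK) : rgal s (\pi_Q a) = \pi_Q (in_qpoly p (map_poly s a)).
Proof.
apply/eqP/pm_piP; case: (pm_reprP a) => ->; first by left.
by right; rewrite !raddfN /= opprK.
Qed.

End ResMu2.

Arguments Rmu2 {K} p.
Arguments rmul {K} p x y.
Arguments rgal {K} p s x.

(* A finite etale k-group scheme is its Galois module of ks-points; here the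
   module has underlying set M in Q, product mulQ and Galois action galQ. It is
   H_f when V_f(ks) is a nonempty homogeneous space, the stabilizer schemes
   H_v are etale (zero Lie algebra), and for each v there is an isomorphism
   M -> H_v(ks) carrying the Galois action on M to the descent datum
   y |-> h^-1 * s(y) * h, where h . s(v) = v. Conjugation has this side because
   [act] reverses products: h^-1 Stab(s v) h = Stab(v). *)
Definition is_descended_stabilizer (k ks : fieldType)
    (iota : {rmorphism k -> ks}) n (f : 'I_n.+1 -> k)
    (Q : Type) (M : set Q) (mulQ : Q -> Q -> Q)
    (galQ : {rmorphism ks -> ks} -> Q -> Q) :=
  [/\ Vf (iota \o f) !=set0,
      forall v w, Vf (iota \o f) v -> Vf (iota \o f) w ->
        exists2 h, SLmu2 ks n h & hact h v = w,
      forall v, Vf (iota \o f) v -> lie_stab v = [set 0] &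
      forall v, Vf (iota \o f) v ->
        exists phi : Q -> modpm 'M[ks]_n,
          [/\ set_bij M (hstab v) phi,
              forall x y, M x -> M y -> phi (mulQ x y) = hmul (phi x) (phi y) &
              forall s h x, is_gal iota s -> SLmu2 ks n h ->
                hact h (map_V s v) = v -> M x ->
                phi (galQ s x) = hmul (hmul (hinv h) (hgal s (phi x))) h]].

(* Main.v *)
(* A vector (A, B) with invariant form f has disc A = f_0, and S = B A^-1 has
   characteristic polynomial g. As g is separable, S has a cyclic vector, so W
   becomes L with S acting as multiplication by x; the forms for which x is
   self-adjoint are (l, m) |-> tau(a l m), with tau the coefficient of x^(n-1)
   and a in L. The base change D to the basis 1, x, ..., x^(n-1) has
   f_0 N(a) = (f_0 det D)^2, which gives the pair (a, t). The centralizer of x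
   is L, so changing D by c in L^* and scaling by d give exactly the equivalence
   of pairs.

   An H(k)-point is the class of e g0 with g0 in GL_n(k) and e^2 = d in k^*:
   take for e a nonzero entry of a representative. This uses that ks has fixed
   field k, which follows from Zorn's lemma applied to the graphs of isomorphisms
   between intermediate rings. The stabilizer of (A, B) consists of the c(T),
   T = A^-1 B, with c^2 = 1 and N(c) = 1, up to sign. As h . s(v) = v conjugates
   s(T) to T, c |-> c(T) carries the Galois action on c to the descent datum. *)

Require Import Defs.
From HB Require Import structures.
From mathcomp Require Import all_boot all_order all_algebra all_field.
From mathcomp Require Import generic_quotient polyXY qpoly.
From mathcomp Require Import boolp classical_sets functions cardinality.

Import GRing.Theory.
Local Open Scope ring_scope.
Local Open Scope classical_set_scope.

Set Implicit Arguments.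
Unset Strict Implicit.
Unset Printing Implicit Defensive.

(** * Cyclic vectors *)

(** An element of least degree divides all others, since remainders stay in the ideal. The ideals
    met below are annihilators of row vectors and of field elements. *)
Lemma poly_ideal_principal (K : fieldType) (I : {poly K} -> Prop) (p0 : {poly K}) :
  (forall p q, I p -> I q -> I (p - q)) -> (forall p q, I q -> I (p * q)) ->
  p0 != 0 -> I p0 ->
  exists r, [/\ r != 0, I r & forall q, I q -> r %| q].
Proof.
move=> IB IM p0N0 Ip0.
pose P m := `[< exists q, [/\ q != 0, I q & size q = m] >].
have exP : exists m, P m by exists (size p0); apply/asboolP; exists p0.
case: (ex_minnP exP) => m /asboolP[r [rN0 Ir <-]] rmin.
exists r; split=> // q Iq; apply/modp_eq0P/eqP/negbNE/negP => qr.
have Iqr : I (q %% r).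
  have -> : q %% r = q - q %/ r * r by rewrite {2}(divp_eq q r) addrC addKr.
  by apply: IB => //; apply: IM.
have := rmin (size (q %% r)); rewrite leqNgt ltn_modp rN0 /= => H.
by apply: notF; apply: H; apply/asboolP; exists (q %% r).
Qed.

Section CyclicVector.
Variables (K : fieldType) (n' : nat).
Local Notation n := n'.+1.
Variable S : 'M[K]_n.
Local Notation h := (char_poly S).

(* Adding a vector whose annihilator is coprime to that of u multiplies the
   annihilators. *)
Lemma cyclic_vector : separable_poly h ->
  (forall q, horner_mx S q = 0 -> h %| q) ->
  exists u : 'rV[K]_n, forall q, u *m horner_mx S q = 0 -> h %| q.
Proof.
move=> hsep hmin.
have hS0 : horner_mx S h = 0 by apply: Cayley_Hamilton.
have hN0 : h != 0 by apply/monic_neq0/char_poly_monic.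
have mulS (w : 'rV[K]_n) p q :
    w *m horner_mx S (p * q) = w *m horner_mx S p *m horner_mx S q.
  by rewrite rmorphM /= -mulmxA.
have mulSC (w : 'rV[K]_n) p q :
    w *m horner_mx S p *m horner_mx S q = w *m horner_mx S q *m horner_mx S p.
  by rewrite -!mulS mulrC.
(* The degree grows step by step: at each stage some [u] is killed only by multiples of a factor [p]
   of [h] whose size is at least [m]. *)
suff H m : (m <= size h)%N -> exists (p : {poly K}) (u : 'rV[K]_n),
    [/\ p %| h, (m <= size p)%N & forall q, u *m horner_mx S q = 0 -> p %| q].
  have [p [u [ph sp pu]]] := H _ (leqnn _).
  exists u => q /pu; apply: dvdp_trans.
  have : size p == size h by rewrite eqn_leq sp dvdp_leq.
  by rewrite dvdp_size_eqp // => /eqp_dvdl <-.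
elim: m => [|m IH] sm.
  by exists 1, 0; split=> // [|q _]; rewrite dvd1p.
have [p [u [ph sp pu]]] := IH (ltnW sm).
have [|sp'] := ltnP m (size p); first by move=> ?; exists p, u.
have pN0 : p != 0 by apply: contraTneq ph => ->; rewrite dvd0p.
pose l := h %/ p; have hE : h = p * l by rewrite mulrC divpK.
have pl : coprimep p l by apply: (separable_coprime hsep); rewrite -hE.
(* So far the annihilator of [u] is only known to lie in (p). As [l] is prime to [p], that of u l(S)
   is exactly (p). *)
pose u1 := u *m horner_mx S l.
have u1p : u1 *m horner_mx S p = 0 by rewrite -mulS mulrC -hE hS0 mulmx0.
have u1q q : u1 *m horner_mx S q = 0 -> p %| q.
  by rewrite -mulS mulrC => /pu; rewrite Gauss_dvdpl.
(* As [p] has smaller degree than [h], p(S) has a nonzero row [w]. It is killed by [l], so its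
   annihilator [r] is a nonconstant divisor of [l], hence prime to [p]. *)
have /eqP pS : horner_mx S p != 0.
  apply/eqP => /hmin /(dvdp_leq pN0) sh.
  by have := leq_trans sm (leq_trans sh sp'); rewrite ltnn.
have [i wN0] : exists i, row i (horner_mx S p) != 0.
  apply/existsP; rewrite -negb_forall; apply/negP => /forallP E; apply: pS.
  by apply/row_matrixP => i; rewrite (eqP (E i)) row0.
set w := row i _ in wN0.
have wl : w *m horner_mx S l = 0.
  by rewrite /w rowE -mulS -hE hS0 mulmx0.
have lN0 : l != 0 by apply: contraNneq hN0 => l0; rewrite hE l0 mulr0.
have [||r [rN0 wr rmin]] :=
    @poly_ideal_principal _ (fun q => w *m horner_mx S q = 0) l _ _ lN0 wl.
- by move=> p1 q1 E1 E2; rewrite rmorphB /= mulmxBr E1 E2 subr0.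
- by move=> p1 q1 E; rewrite mulrC mulS E mul0mx.
have rl : r %| l by apply: rmin.
have pr : coprimep p r by apply: coprimep_dvdl rl pl.
exists (p * r), (u1 + w); split; first by rewrite hE dvdp_mul2l.
- have sr : (1 < size r)%N.
    rewrite ltnNge; apply/negP => sr; move: wr.
    have/size_poly1P[c cN0 ->] : size r == 1%N.
      by rewrite eqn_leq sr size_poly_gt0.
    rewrite horner_mx_C mul_mx_scalar => /eqP.
    by rewrite scaler_eq0 (negPf cN0) (negPf wN0).
  rewrite size_mul //; move: sr; case: (size r) => [|[|s]] // _.
  by rewrite !addnS /= ltnS (leq_trans sp) ?leq_addr.
- move=> q; rewrite mulmxDl => E.
  rewrite Gauss_dvdp //; apply/andP; split.
    rewrite -(Gauss_dvdpl _ pr); apply: u1q; rewrite mulS.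
    have : u1 *m horner_mx S q *m horner_mx S r +
           w *m horner_mx S q *m horner_mx S r = 0.
      by rewrite -mulmxDl E mul0mx.
    by rewrite [X in _ + X]mulSC wr mul0mx addr0.
  rewrite -(Gauss_dvdpr _ (_ : coprimep r p)) 1?coprimep_sym //.
  apply: rmin; rewrite mulrC mulS.
  have : u1 *m horner_mx S q *m horner_mx S p +
         w *m horner_mx S q *m horner_mx S p = 0.
    by rewrite -mulmxDl E mul0mx.
  by rewrite [X in X + _]mulSC u1p mul0mx add0r.
Qed.

End CyclicVector.

(** Every root of the characteristic polynomial is an eigenvalue, hence a root of the minimal
    polynomial; as the roots are distinct over [F], the former divides the latter. *)
Lemma separable_split_minpoly (K F : fieldType) (j : {rmorphism K -> F}) n'
    (S : 'M[K]_n'.+1) (rs : seq F) :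
  map_poly j (char_poly S) = \prod_(r <- rs) ('X - r%:P) -> uniq rs ->
  forall q, horner_mx S q = 0 -> char_poly S %| q.
Proof.
move=> hE rsU q /mxminpoly_min; apply: dvdp_trans.
rewrite -(dvdp_map j) hE -mxminpoly_map.
apply: uniq_roots_dvdp; last by rewrite uniq_rootsE.
apply/allP => r rrs; rewrite root_mxminpoly -map_char_poly hE.
by rewrite root_prod_XsubC.
Qed.

(** * The companion matrix and the algebra K[x]/(h) *)

(** This is [companionmx] with the size as a parameter, which gives it the type ['M_n]. For [h]
    monic of degree n it acts on row vectors as multiplication by x in the basis 1, x, ..., x^(n-1)
    of K[x]/(h). *)
Definition compmx (R : nzRingType) n (h : {poly R}) : 'M[R]_n :=
  \matrix_(i, l) if i == n.-1 :> nat then - h`_l else (i.+1 == l :> nat)%:R.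

(** Only the last entry of the first row contributes, with sign (-1)^(n-1), and its minor has the
    same shape; the exponents add up to n(n-1)/2. *)
Lemma det_antitriangular (R : comNzRingType) n (A : 'M[R]_n) :
  (forall i l : 'I_n, (i + l < n.-1)%N -> A i l = 0) ->
  (forall i l : 'I_n, (i + l)%N = n.-1 -> A i l = 1) ->
  \det A = (-1) ^+ (n * n.-1)./2.
Proof.
elim: n A => [|n IH] A A0 A1; first by rewrite det_mx00.
rewrite (expand_det_row _ ord0) (bigD1 ord_max) //= big1 ?addr0; last first.
  move=> i iN; rewrite A0 ?mul0r //= add0n.
  by rewrite ltn_neqAle -ltnS ltn_ord andbT.
rewrite A1 //= mul1r /cofactor /= add0n IH /=.
- rewrite -exprD; congr (_ ^+ _).
  by rewrite -[(n.+1 * n)%N]/(n.+1 * n.+1.-1)%N -!bin2 binS bin1 addnC.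
- move=> i l il; rewrite !mxE; apply: A0.
  rewrite lift0 lift_max addSn.
  by case: n i l il {IH A A1} => [|n] i l //=.
- move=> i l il; rewrite !mxE; apply: A1.
  by rewrite lift0 lift_max addSn il; case: n i {l il IH A A0} => [[]|].
Qed.

Section Companion.
Variables (K : fieldType) (n' : nat) (h : {poly K}).
Local Notation n := n'.+1.
Hypotheses (hm : h \is monic) (sh : size h = n.+1).
Local Notation C := (compmx n h).
Local Notation e0 := (delta_mx 0 0 : 'rV[K]_n).

Lemma char_poly_compmx : char_poly C = h.
Proof.
have H m : m = (size h).-1 -> char_poly (compmx m h) = h.
  by move=> ->; apply: companionmxK.
by apply: H; rewrite sh.
Qed.

Lemma delta_compmxX (i : 'I_n) : e0 *m C ^+ i = delta_mx 0 i.
Proof.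
case: i => i lt_i; elim: i lt_i => [|i IH] lt_i.
  by rewrite expr0 mulmx1; congr delta_mx; apply: val_inj.
rewrite exprSr mulmxA (IH (ltnW lt_i)) -rowE.
apply/rowP => l; rewrite !mxE /= ifN ?eqxx.
  by rewrite -val_eqE /= eq_sym.
by rewrite neq_ltn -ltnS lt_i.
Qed.

Lemma delta_horner_compmx (q : {poly K}) : (size q <= n)%N ->
  e0 *m horner_mx C q = poly_rV q.
Proof.
move=> sq; have -> : q = \sum_(i < n) q`_i *: 'X^i.
  by rewrite -poly_def; apply/polyP => i; rewrite coef_poly;
     case: ltnP => // /(leq_trans sq)/(nth_default 0).
rewrite !linear_sum /=; apply: eq_bigr => i _.
rewrite !linearZ /= rmorphXn /= horner_mx_X delta_compmxX.
congr (_ *: _); apply/rowP => l; rewrite !mxE eqxx coefXn.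
by rewrite -val_eqE.
Qed.

Lemma row_horner_compmx (i : 'I_n) (q : {poly K}) :
  row i (horner_mx C q) = e0 *m horner_mx C (q * 'X^i).
Proof.
rewrite mulrC rmorphM rmorphXn /= horner_mx_X.
by rewrite -[_ * horner_mx _ _]/(_ *m _) mulmxA delta_compmxX -rowE.
Qed.

(** The first basis vector is cyclic for [C], so a matrix commuting with [C] is determined by its
    first row, and some polynomial in [C] has the same first row. *)
Lemma comm_compmx (X : 'M[K]_n) : X *m C = C *m X ->
  exists2 q : {poly K}, (size q <= n)%N & X = horner_mx C q.
Proof.
move=> XC; exists (rVpoly (e0 *m X)); first exact: size_poly.
have XCi i : X *m C ^+ i = C ^+ i *m X.
  by apply: commrX; rewrite /GRing.comm.
apply/row_matrixP => i.
rewrite row_horner_compmx mulrC [horner_mx C (_ * _)]rmorphM rmorphXn /=.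
rewrite horner_mx_X -[_ * horner_mx _ _]/(_ *m _).
have -> : C ^+ i *m horner_mx C (rVpoly (e0 *m X)) =
          horner_mx C (rVpoly (e0 *m X)) *m C ^+ i.
  by apply: commr_sym; apply: commrX; apply: comm_horner_mx.
rewrite mulmxA delta_horner_compmx ?size_poly // rVpolyK -mulmxA XCi.
by rewrite mulmxA delta_compmxX -rowE.
Qed.

Lemma horner_mx_modp (S : 'M[K]_n) (q : {poly K}) : char_poly S = h ->
  horner_mx S (q %% h) = horner_mx S q.
Proof.
move=> Sh; rewrite {2}(divp_eq q h) rmorphD rmorphM /=.
by have := Cayley_Hamilton S; rewrite Sh => ->; rewrite mulr0 add0r.
Qed.

(** The Gram matrix of (l, m) |-> tau(l m) in the basis of powers of x, with tau the coefficient of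
    x^(n-1): the first row of [C ^+ m] holds the coordinates of x^m, so its last entry is
    tau(x^m). *)
Definition gramJ : 'M[K]_n := \matrix_(i, l) (C ^+ (i + l)) ord0 ord_max.
Local Notation J := gramJ.

Lemma compmxX_max (i : 'I_n) l : (C ^+ l) i ord_max = (C ^+ (i + l)) ord0 ord_max.
Proof.
have E k (A : 'M[K]_n) : A k ord_max = ((delta_mx 0 k : 'rV_n) *m A) 0 ord_max.
  by rewrite -rowE mxE.
rewrite [LHS]E -delta_compmxX -mulmxA.
by rewrite -[C ^+ i *m C ^+ l]/(C ^+ i * C ^+ l) -exprD -E.
Qed.

Lemma gramJ_sym : J^T = J.
Proof. by apply/matrixP => i l; rewrite !mxE addnC. Qed.

(** Multiplication by x is self-adjoint for tau(l m): the entries of [C *m J] are the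
    tau(x^(i+l+1)), symmetric in i and l. *)
Lemma compmx_gramJ : C *m J = J *m C^T.
Proof.
rewrite -{2}gramJ_sym -trmx_mul.
have E (i l : 'I_n) : (C *m J) i l = (C ^+ (i + l.+1)) ord0 ord_max.
  rewrite -compmxX_max exprS !mxE; apply: eq_bigr => m _.
  by rewrite [J _ _]mxE -compmxX_max.
by apply/matrixP => i l; rewrite [RHS]mxE !E !addnS addnC.
Qed.

Lemma horner_gramJ q : horner_mx C q *m J = J *m (horner_mx C q)^T.
Proof.
elim/poly_ind: q => [|q c IH]; first by rewrite rmorph0 trmx0 mul0mx mulmx0.
rewrite rmorphD rmorphM /= horner_mx_C horner_mx_X.
rewrite -[_ * C]/(_ *m C) linearD /= trmx_mul tr_scalar_mx mulmxDl mulmxDr.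
rewrite scalar_mxC; congr (_ + _).
rewrite -mulmxA compmx_gramJ mulmxA IH -!mulmxA; congr (_ *m _).
rewrite -!trmx_mul; congr (_^T).
by apply: commr_sym; apply: comm_horner_mx.
Qed.

(** tau(x^m) is 0 for m < n-1 and 1 for m = n-1, so [J] is antitriangular. Its determinant is the
    sign in [disc], whence [disc J = 1]. *)
Lemma det_gramJ : \det J = (-1) ^+ (n * n.-1)./2.
Proof.
have E (i l : 'I_n) : (i + l < n)%N -> J i l = ((i + l)%N == n')%:R.
  move=> il; rewrite mxE; have := delta_compmxX (Ordinal il).
  rewrite -rowE => /rowP/(_ ord_max); rewrite !mxE /= => ->.
  by rewrite -val_eqE /= eq_sym.
apply: det_antitriangular => i l /= il.
  by rewrite E ?ltn_eqF // ltnW.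
by rewrite E il ?ltnSn ?eqxx.
Qed.

Lemma unit_gramJ : J \in unitmx.
Proof. by rewrite unitmxE det_gramJ unitrX ?unitrN1. Qed.

Lemma disc_gramJ : disc J = 1.
Proof. by rewrite /disc det_gramJ -exprD addnn -mul2n exprM sqrrN expr1n expr1n. Qed.

Lemma mk_monicE : mk_monic h = h.
Proof. by rewrite /mk_monic hm sh. Qed.

Lemma in_qpolyE q : in_qpoly h q = q %% h :> {poly K}.
Proof. by rewrite /= mk_monicE Pdiv.IdomainMonic.modpE. Qed.

Lemma in_qpolyK (a : {poly %/ h}) : in_qpoly h a = a.
Proof. by apply: val_inj; apply: in_qpoly_small; apply: size_mk_monic. Qed.

Lemma size_qpoly (a : {poly %/ h}) : (size a <= n)%N.
Proof.
have E : size (mk_monic h) = n.+1 by rewrite mk_monicE.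
by have := size_mk_monic a; rewrite [X in (_ < X)%N]E.
Qed.

Section Similar.
Variable S : 'M[K]_n.
Hypothesis Sh : char_poly S = h.

Lemma horner_in_qpoly q : horner_mx S (in_qpoly h q) = horner_mx S q.
Proof. by rewrite in_qpolyE horner_mx_modp. Qed.

Lemma horner_qpolyM (a b : {poly %/ h}) :
  horner_mx S (a * b : {poly %/ h}) = horner_mx S a *m horner_mx S b.
Proof.
by rewrite -[a in LHS]in_qpolyK -[b in LHS]in_qpolyK -rmorphM horner_in_qpoly rmorphM.
Qed.

Lemma horner_qpoly1 : horner_mx S (1 : {poly %/ h}) = 1%:M.
Proof. by rewrite -(rmorph1 (in_qpoly h)) horner_in_qpoly rmorph1. Qed.

End Similar.

Lemma horner_qpoly_inj (a b : {poly %/ h}) :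
  horner_mx C a = horner_mx C b -> a = b.
Proof.
move=> E; apply: val_inj; rewrite /= -(poly_rV_K (size_qpoly a)).
by rewrite -delta_horner_compmx ?size_qpoly // E delta_horner_compmx
  ?size_qpoly // poly_rV_K ?size_qpoly.
Qed.

Lemma comm_compmx_qpoly (X : 'M[K]_n) : X *m C = C *m X ->
  exists a : {poly %/ h}, X = horner_mx C a.
Proof.
case/comm_compmx => q sq ->; exists (in_qpoly h q).
by rewrite horner_in_qpoly // char_poly_compmx.
Qed.

(** Row i of a(C) lists the coefficients of a x^i, so a(C) is the matrix in the definition of
    [qnorm]. *)
Lemma qnormE (a : {poly %/ h}) : qnorm a = \det (horner_mx C a).
Proof.
(* The size of the matrix in [qnorm] equals [n] only by a proof, so the matrix is abstracted over
   its size before that is rewritten. *)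
pose M m : 'M[K]_m := \matrix_(i, l) (a * in_qpoly h 'X^i : {poly %/ h})`_l.
have nE : (size (mk_monic h)).-1 = n by rewrite mk_monicE sh.
have -> : qnorm a = \det (M n) by rewrite -[in RHS]nE.
congr (\det _); apply/row_matrixP => i; rewrite row_horner_compmx.
rewrite -(horner_in_qpoly char_poly_compmx) in_qpolyM in_qpolyK.
rewrite delta_horner_compmx ?size_qpoly //.
by apply/rowP => l; rewrite !mxE.
Qed.

Lemma qnormM (a b : {poly %/ h}) : qnorm (a * b) = qnorm a * qnorm b.
Proof. by rewrite !qnormE horner_qpolyM ?char_poly_compmx // det_mulmx. Qed.

Lemma qnorm1 : qnorm (1 : {poly %/ h}) = 1.
Proof. by rewrite qnormE horner_qpoly1 ?char_poly_compmx // det1. Qed.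

(** The inverse of an invertible a(C) commutes with [C], so it is again of the form b(C). *)
Lemma qpoly_unitE (a : {poly %/ h}) : (a \is a GRing.unit) = (qnorm a != 0).
Proof.
apply/idP/idP => [aU|aN].
  apply: contraTneq (oner_neq0 K) => a0.
  by rewrite -qnorm1 -(mulrV aU) qnormM a0 mul0r eqxx.
have aU : horner_mx C a \in unitmx by rewrite unitmxE -qnormE unitfE.
have aC : horner_mx C a *m C = C *m horner_mx C a by apply: comm_horner_mx.
have [|b bE] := @comm_compmx_qpoly (invmx (horner_mx C a)).
  by rewrite -[LHS](mulmxK aU) -(mulmxA _ C) -aC mulKmx.
apply/unitrP; exists b; rewrite mulrC; split;
by apply: horner_qpoly_inj; rewrite horner_qpolyM ?char_poly_compmx // -bE
  mulmxV // horner_qpoly1 ?char_poly_compmx.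
Qed.

(** For a cyclic vector [u], the rows u S^i form a base change [D] taking [S] to the companion
    matrix. The distinct roots over [F] make [h] separable and the minimal polynomial of [S], so
    that such a [u] exists. *)
Lemma similar_compmx (F : fieldType) (j : {rmorphism K -> F}) (rs : seq F)
    (S : 'M[K]_n) :
  map_poly j h = \prod_(r <- rs) ('X - r%:P) -> uniq rs -> char_poly S = h ->
  exists2 D : 'M[K]_n, D \in unitmx & D *m S = C *m D.
Proof.
move=> hE rsU Sh.
have hsep : separable_poly (char_poly S).
  by rewrite Sh -(separable_map j) hE separable_prod_XsubC.
have [|u uP] := cyclic_vector hsep.
  by apply: (separable_split_minpoly (j := j) _ rsU); rewrite Sh.
rewrite Sh in uP.
pose D : 'M[K]_n := \matrix_i (u *m S ^+ i).
have wD (w : 'rV[K]_n) : w *m D = u *m horner_mx S (rVpoly w).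
  rewrite {2}[w]matrix_sum_delta.
  rewrite big_ord1 !linear_sum /= mulmx_sum_row; apply: eq_bigr => i _.
  by rewrite !linearZ /= rVpoly_delta rowK rmorphXn /= horner_mx_X.
have Dfree (w : 'rV[K]_n) : w *m D = 0 -> w = 0.
  rewrite wD => /uP wh; rewrite -[w]rVpolyK.
  suff -> : rVpoly w = 0 by rewrite linear0.
  apply/eqP; apply: contraTT wh => wN0; apply/negP => /(dvdp_leq wN0).
  by rewrite leqNgt sh ltnS size_poly.
have DU : D \in unitmx.
  rewrite -row_free_unit; apply/inj_row_free => w /Dfree; exact.
exists D => //; apply/row_matrixP => i.
rewrite row_mul rowK -mulmxA -[S ^+ i *m S]/(S ^+ i * S) -exprSr row_mul.
rewrite wD; have -> : row i C = poly_rV ('X^(i.+1) %% h).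
  rewrite -delta_horner_compmx; last by rewrite -ltnS -sh ltn_modp monic_neq0.
  rewrite horner_mx_modp ?char_poly_compmx // rmorphXn /= horner_mx_X exprSr.
  by rewrite -[_ * C]/(_ *m C) mulmxA delta_compmxX -rowE.
rewrite poly_rV_K; last by rewrite -ltnS -sh ltn_modp monic_neq0.
by rewrite horner_mx_modp // rmorphXn /= horner_mx_X.
Qed.

End Companion.

(** * The fixed field of the Galois group *)

Lemma root_map_dvdp (E K : fieldType) (i : {rmorphism E -> K}) x
    (p q : {poly E}) :
  p %| q -> root (map_poly i p) x -> root (map_poly i q) x.
Proof.
move=> /dvdpP[s ->]; rewrite rmorphM rootM => ->; exact: orbT.
Qed.

(** The annihilator [r'] of [y] divides [r], say [r = s * r']. If [x] were a root of [s], minimality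
    of [r] would make [r'] constant, impossible as it has the root [y]; so [x] is a root of [r']. *)
Lemma root_map_conj (E K : fieldType) (i phi : {rmorphism E -> K}) x y
    (r : {poly E}) :
  r != 0 -> root (map_poly i r) x ->
  (forall q, root (map_poly i q) x -> r %| q) -> root (map_poly phi r) y ->
  forall q, root (map_poly i q) x <-> root (map_poly phi q) y.
Proof.
move=> rN0 rx rmin ry q; split; first by move/rmin/root_map_dvdp; apply.
move=> qy.
have [||r' [r'N0 r'y r'min]] :=
    @poly_ideal_principal _ (fun q => root (map_poly phi q) y) r _ _ rN0 ry.
- by move=> p1 q1; rewrite /root rmorphB hornerD hornerN => /eqP-> /eqP->; rewrite subr0.
- by move=> p1 q1; rewrite rmorphM rootM => ->; rewrite orbT.
apply: (root_map_dvdp (r'min _ qy)).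
have /dvdpP[s rE] := r'min _ ry.
move: rx; rewrite rE rmorphM rootM => /orP[/rmin|//] rs.
have sN0 : s != 0 by apply: contraNneq rN0 => s0; rewrite rE s0 mul0r.
have := dvdp_leq sN0 rs; rewrite rE size_mul // => le1.
have : size r' == 1%N.
  rewrite eqn_leq size_poly_gt0 r'N0 andbT.
  move: le1; move: (r'N0) (sN0); rewrite -!size_poly_gt0.
  by case: (size r') => // a; case: (size s) => // b _ _;
     rewrite addnS /= -[X in (_ <= X)%N]addn0 leq_add2l.
case/size_poly1P => c cN0 r'E; move: r'y; rewrite r'E map_polyC rootC.
by rewrite fmorph_eq0 (negPf cN0).
Qed.

Section SeparableClosure.
Variables (k ks : fieldType) (iota : {rmorphism k -> ks}).
Hypothesis hks : is_separable_closure iota.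

(* The graph of an isomorphism between two subrings of ks, over k. *)
Definition partial_iso (G : set (ks * ks)) :=
  [/\ forall c, G (iota c, iota c),
      forall a b a' b', G (a, b) -> G (a', b') -> G (a - a', b - b'),
      forall a b a' b', G (a, b) -> G (a', b') -> G (a * a', b * b') &
      forall a b, G (a, b) -> (a == 0) = (b == 0)].

Lemma min_annihilator (E : fieldType) (i : {rmorphism E -> ks}) x
    (p : {poly E}) : p != 0 -> root (map_poly i p) x ->
  exists r, [/\ r != 0, root (map_poly i r) x &
                forall q, root (map_poly i q) x -> r %| q].
Proof.
move=> pN0 px.
apply: (@poly_ideal_principal _ (fun q => root (map_poly i q) x) p _ _ pN0 px).
  by move=> p1 q1; rewrite /root rmorphB hornerD hornerN => /eqP-> /eqP->; rewrite subr0.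
by move=> p1 q1; rewrite rmorphM rootM => ->; rewrite orbT.
Qed.

(** The set is the graph of the map i(E)[x] -> phi(E)[y] sending i(c) to phi(c) and x to y. The
    hypothesis on polynomials makes it well defined and injective. *)
Lemma conj_partial_iso (E : fieldType) (i phi : {rmorphism E -> ks})
    (iotaE : k -> E) x y :
  (forall c, i (iotaE c) = iota c) -> (forall c, phi (iotaE c) = iota c) ->
  (forall q, root (map_poly i q) x <-> root (map_poly phi q) y) ->
  partial_iso [set ((map_poly i q).[x], (map_poly phi q).[y]) | q in setT].
Proof.
move=> iE phiE xy; split.
- by move=> c; exists (iotaE c)%:P => //; rewrite !map_polyC !hornerC /= iE phiE.
- move=> a b a' b' [q _ [<- <-]] [q' _ [<- <-]].
  by exists (q - q') => //; rewrite !rmorphB !hornerD !hornerN.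
- move=> a b a' b' [q _ [<- <-]] [q' _ [<- <-]].
  by exists (q * q') => //; rewrite !rmorphM !hornerM.
- by move=> a b [q _ [<- <-]]; apply/idP/idP => /xy.
Qed.

Lemma partial_iso_sym G : partial_iso G -> partial_iso [set ab | G (ab.2, ab.1)].
Proof.
move=> [G1 GB GM G0]; split=> //=.
- by move=> a b a' b'; apply: GB.
- by move=> a b a' b'; apply: GM.
- by move=> a b /G0.
Qed.

Lemma partial_iso_fun G a b b' : partial_iso G -> G (a, b) -> G (a, b') -> b = b'.
Proof.
move=> [G1 GB GM G0] Gb Gb'; have := G0 _ _ (GB _ _ _ _ Gb Gb').
by rewrite subrr eqxx subr_eq0 => /esym/eqP.
Qed.

(** As [a] is algebraic over k, its inverse is a polynomial in [a] with coefficients in k; the same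
    polynomial in [b] is the inverse of [b]. Hence the domain of [G] is a field. *)
Lemma partial_isoV G a b : partial_iso G -> G (a, b) -> G (a^-1, b^-1).
Proof.
move=> GI Gab; have [G1 GB GM G0] := GI.
have [a0|aN0] := eqVneq a 0.
  have := G0 _ _ Gab; rewrite a0 eqxx => /esym/eqP b0.
  by move: Gab; rewrite a0 b0 !invr0.
have G00 : G (0, 0) by have := G1 0; rewrite rmorph0.
have GD c d c' d' : G (c, d) -> G (c', d') -> G (c + c', d + d').
  move=> Gcd Gcd'; have := GB _ _ _ _ Gcd (GB _ _ _ _ G00 Gcd').
  by rewrite !sub0r !opprK.
have Gp q : G ((map_poly iota q).[a], (map_poly iota q).[b]).
  elim/poly_ind: q => [|q c IH]; first by rewrite rmorph0 !horner0.
  rewrite rmorphD rmorphM /= map_polyX map_polyC !hornerE.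
  exact/GD/G1/GM.
have [p psep pa] := hks.1 a.
have [r [rN0 ra rmin]] := min_annihilator (separable_poly_neq0 psep) pa.
(* If the constant term vanished, [r] divided by X would still kill the nonzero [a], against
   minimality. *)
have cN0 : r.[0] != 0.
  apply/negP => r0; have : 'X %| r by rewrite -['X]subr0 -polyC0 dvdp_XsubCl.
  case/dvdpP => s rE; move: ra.
  rewrite rE rmorphM rootM /= map_polyX rootX (negPf aN0) orbF => /rmin.
  have sN0 : s != 0 by apply: contraNneq rN0 => s0; rewrite rE s0 mul0r.
  by move/(dvdp_leq sN0); rewrite rE size_mulX // ltnn.
have [s rE] : exists s, r = s * 'X + r.[0]%:P.
  have : 'X %| r - r.[0]%:P.
    by rewrite -['X]subr0 -polyC0 dvdp_XsubCl /root !hornerE subrr.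
  by case/dvdpP => s /eqP; rewrite subr_eq => /eqP; exists s.
(* From r = s X + r(0), the inverse of [a] is - s(a) / r(0). *)
have := Gp (- r.[0]^-1 *: s); set q := (map_poly iota _).
have aq : a * q.[a] = 1.
  move: ra; rewrite /root {1}rE rmorphD rmorphM /= map_polyX map_polyC !hornerE /=.
  rewrite addr_eq0 => /eqP E.
  rewrite /q map_polyZ hornerZ mulrCA [a * _]mulrC E.
  by rewrite rmorphN fmorphV mulrNN mulVf // fmorph_eq0.
move=> Gq; have Gaq := GM _ _ _ _ Gab Gq; rewrite aq in Gaq.
have G11 : G (1, 1) by have := G1 1; rewrite rmorph1.
have bq := partial_iso_fun GI Gaq G11.
have bN0 : b != 0 by rewrite -(G0 _ _ Gab).
have -> : a^-1 = q.[a] by apply: (mulfI aN0); rewrite aq divff.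
have -> : b^-1 = q.[b] by apply: (mulfI bN0); rewrite bq divff.
exact: Gq.
Qed.

Section Domain.
Variable G : set (ks * ks).
Hypothesis GI : partial_iso G.

Definition dom_pred : {pred ks} := fun x => `[< exists y, G (x, y) >].

Fact dom_divring_closed : divring_closed dom_pred.
Proof.
have [G1 GB GM G0] := GI; split.
- by apply/asboolP; exists 1; have := G1 1; rewrite rmorph1.
- move=> x x' /asboolP[y Gxy] /asboolP[y' Gxy']; apply/asboolP.
  by exists (y - y'); apply: GB.
- move=> x x' /asboolP[y Gxy] /asboolP[y' Gxy']; apply/asboolP.
  by exists (y / y'); apply: GM => //; apply: partial_isoV.
Qed.

HB.instance Definition _ :=
  GRing.isDivringClosed.Build ks dom_pred dom_divring_closed.

(** The domain of [G] becomes a field type of its own, over which minimal polynomials can be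
    taken. *)
Record domain := Domain { domain_val :> ks; _ : domain_val \in dom_pred }.

HB.instance Definition _ := [isSub for domain_val].
HB.instance Definition _ := [Choice of domain by <:].
HB.instance Definition _ := [SubChoice_isSubIntegralDomain of domain by <:].
HB.instance Definition _ := [SubIntegralDomain_isSubField of domain by <:].

Lemma domainP (x : domain) : exists y, G (val x, y).
Proof. exact/asboolP/(valP x). Qed.

Definition domain_iso (x : domain) : ks := projT1 (cid (domainP x)).

Lemma domain_isoP (x : domain) : G (val x, domain_iso x).
Proof. exact: projT2 (cid (domainP x)). Qed.

Fact domain_iso_zmod : zmod_morphism domain_iso.
Proof.
move=> x y; have [G1 GB GM G0] := GI.
apply: (partial_iso_fun GI (domain_isoP _)).
by rewrite rmorphB; apply: GB; apply: domain_isoP.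
Qed.

Fact domain_iso_monoid : monoid_morphism domain_iso.
Proof.
have [G1 GB GM G0] := GI; split.
  apply: (partial_iso_fun GI (domain_isoP _)).
  by rewrite rmorph1; have := G1 1; rewrite rmorph1.
move=> x y; apply: (partial_iso_fun GI (domain_isoP _)).
by rewrite rmorphM; apply: GM; apply: domain_isoP.
Qed.

HB.instance Definition _ :=
  GRing.isZmodMorphism.Build domain ks domain_iso domain_iso_zmod.
HB.instance Definition _ :=
  GRing.isMonoidMorphism.Build domain ks domain_iso domain_iso_monoid.

Fact iota_domain c : iota c \in dom_pred.
Proof. by have [G1 _ _ _] := GI; apply/asboolP; exists (iota c). Qed.

(** The minimal polynomial of [x] over the domain is separable, and so is its image under the
    isomorphism, which thus has a root [y] in ks; [x] is sent to [y]. *)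
Lemma extend_partial_iso x :
  exists G', [/\ partial_iso G', G `<=` G' & exists y, G' (x, y)].
Proof.
have [G1 GB GM G0] := GI.
pose i : {rmorphism domain -> ks} := val.
pose phi : {rmorphism domain -> ks} := domain_iso.
pose iotaE c := Domain (iota_domain c).
have iE c : i (iotaE c) = iota c by [].
have phiE c : phi (iotaE c) = iota c.
  exact: (partial_iso_fun GI (domain_isoP (iotaE c)) (G1 c)).
have [p psep px] := hks.1 x.
pose pE : {poly domain} := \poly_(m < size p) iotaE p`_m.
have pEE : map_poly i pE = map_poly iota p.
  apply/polyP => m; rewrite !coef_map coef_poly.
  by case: ltnP => // sm; rewrite (nth_default _ sm) !raddf0.
have pEsep : separable_poly pE by rewrite -(separable_map i) pEE separable_map.
have pEx : root (map_poly i pE) x by rewrite pEE.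
have [r [rN0 rx rmin]] := min_annihilator (separable_poly_neq0 pEsep) pEx.
have rsep : separable_poly (map_poly phi r).
  by rewrite separable_map; apply: dvdp_separable (rmin _ pEx) pEsep.
have [|y ry] := hks.2 _ rsep.
  rewrite size_map_poly ltnNge; apply/negP => sr.
  have/size_poly1P[c cN0 rE] : size r == 1%N.
    by rewrite eqn_leq sr size_poly_gt0.
  by move: rx; rewrite rE map_polyC rootC fmorph_eq0 (negPf cN0).
have xy := root_map_conj rN0 rx rmin ry.
exists [set ((map_poly i q).[x], (map_poly phi q).[y]) | q in setT].
split; first exact: conj_partial_iso iE phiE xy.
  move=> [a b] Gab; have aD : a \in dom_pred by apply/asboolP; exists b.
  exists (Domain aD)%:P => //; rewrite !map_polyC !hornerC /=.
  congr (_, _); exact: (partial_iso_fun GI (domain_isoP (Domain aD)) Gab).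
by exists y, 'X => //; rewrite !map_polyX !hornerX.
Qed.

End Domain.

Lemma maximal_partial_iso G0 : partial_iso G0 ->
  exists G, [/\ partial_iso G, G0 `<=` G &
                forall G', partial_iso G' -> G `<=` G' -> G' `<=` G].
Proof.
(* Zorn's lemma must also bound the empty chain, whose union is empty. It is therefore applied to
   the sets to be added to [G0]. *)
move=> G0I; pose P := [set X : set (ks * ks) | partial_iso (G0 `|` X)].
have P0 : P set0 by rewrite /P /= setU0.
have [F FP Ftot|A [PA Amax]] := @Zorn_bigcup _ P; last first.
  exists (G0 `|` A); split=> // G' G'I AG'.
  have G0G' : G0 `|` G' = G' by apply/setUidPr => ? ?; apply: AG'; left.
  have AG : A `<=` G' by move=> ? ?; apply: AG'; right.
  have [GA|nGA] := pselect (G' `<=` A); first by move=> z /GA; right.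
  by exfalso; apply: (Amax G' (conj AG nGA)); rewrite /P /= G0G'.
(* Two pairs of the union already lie in one partial isomorphism below it, because the chain is
   totally ordered. *)
have cover p q : (G0 `|` \bigcup_(X in F) X) p ->
    (G0 `|` \bigcup_(X in F) X) q ->
    exists X, [/\ partial_iso (G0 `|` X), (G0 `|` X) p, (G0 `|` X) q &
                  G0 `|` X `<=` G0 `|` \bigcup_(X in F) X].
  have sub X : F X -> G0 `|` X `<=` G0 `|` \bigcup_(X in F) X.
    by move=> FX z [?|Xz]; [left|right; exists X].
  move=> [G0p|[X FX Xp]] [G0q|[Y FY Yq]].
  - by exists set0; rewrite !setU0; split=> // z; left.
  - by exists Y; split; [exact: FP|left|right|exact: sub].
  - by exists X; split; [exact: FP|right|left|exact: sub].
  - have [XY|YX] := Ftot _ _ FX FY.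
      by exists Y; split; [exact: FP|right; apply: XY|right|exact: sub].
    by exists X; split; [exact: FP|right|right; apply: YX|exact: sub].
rewrite /P /=; split.
- by move=> c; left; case: G0I.
- move=> a b a' b' p q; have [X [[_ GB _ _] Xp Xq sX]] := cover _ _ p q.
  by apply: sX; apply: GB.
- move=> a b a' b' p q; have [X [[_ _ GM _] Xp Xq sX]] := cover _ _ p q.
  by apply: sX; apply: GM.
- move=> a b p; have [X [[_ _ _ GZ] Xp _ _]] := cover _ _ p p.
  exact: GZ.
Qed.

(** A maximal partial isomorphism is total by the extension lemma, and surjective by the same lemma
    applied to its inverse graph. *)
Lemma partial_iso_gal G0 : partial_iso G0 ->
  exists2 s : {rmorphism ks -> ks}, is_gal iota s &
    forall a b, G0 (a, b) -> s a = b.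
Proof.
move=> /maximal_partial_iso[G [GI G0G Gmax]].
have GIs := partial_iso_sym GI.
have tot x : exists y, G (x, y).
  have [G' [G'I GG' [y Gy]]] := extend_partial_iso GI x.
  by exists y; apply: Gmax Gy.
have surj y : exists x, G (x, y).
  have [G' [G'I GG' [x Gx]]] := extend_partial_iso GIs y.
  exists x; apply: (Gmax [set ab | G' (ab.2, ab.1)]) => //.
    exact: partial_iso_sym.
  by move=> [a b] Gab; apply: GG'.
pose s x := projT1 (cid (tot x)).
have sP x : G (x, s x) := projT2 (cid (tot x)).
have sE x y : G (x, y) -> s x = y by apply: partial_iso_fun.
have [G1 GB GM _] := GI.
have sB : zmod_morphism s by move=> x y; apply/sE/GB.
have sM : monoid_morphism s.
  split=> [|x y]; last exact/sE/GM.
  by apply: sE; have := G1 1; rewrite rmorph1.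
pose sr : {rmorphism ks -> ks} :=
  HB.pack s (GRing.isZmodMorphism.Build _ _ s sB)
            (GRing.isMonoidMorphism.Build _ _ s sM).
exists sr => [|a b /G0G]; last exact: sE.
split=> [|x]; last exact: sE.
pose t y := projT1 (cid (surj y)).
have tP y : G (t y, y) := projT2 (cid (surj y)).
exists t => [x|y]; last exact: sE.
exact: (partial_iso_fun GIs (tP _) (sP x)).
Qed.

(** A further root [y] of the minimal polynomial of [x] over k would differ from [x] by
    separability, and some automorphism over k would take [x] to [y]. So that polynomial is
    linear. *)
Lemma gal_fixed x : (forall s, is_gal iota s -> s x = x) ->
  exists c, x = iota c.
Proof.
move=> xfix; have [p psep px] := hks.1 x.
have [r [rN0 rx rmin]] := min_annihilator (separable_poly_neq0 psep) px.
have rsep : separable_poly (map_poly iota r).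
  by rewrite separable_map; apply: dvdp_separable (rmin _ px) psep.
have /dvdpP[q rE] : 'X - x%:P %| map_poly iota r by rewrite dvdp_XsubCl.
have qN0 : q != 0.
  by apply: contraNneq rN0 => q0; rewrite -(map_poly_eq0 iota) rE q0 mul0r.
have qsep : separable_poly q.
  by apply: dvdp_separable rsep; rewrite rE dvdp_mulr.
have [sq|sq] := ltnP 1 (size q).
  have [y qy] := hks.2 _ qsep sq.
  have ry : root (map_poly iota r) y by rewrite rE rootM qy.
  have xy := root_map_conj rN0 rx rmin ry.
  have [s sgal sP] := partial_iso_gal
    (@conj_partial_iso k iota iota id x y (fun=> erefl) (fun=> erefl) xy).
  have sxy : s x = y by apply: sP; exists 'X => //; rewrite map_polyX !hornerX.
  move: rsep; rewrite rE separable_mul => /and3P[_ _].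
  by rewrite coprimep_XsubC -(xfix _ sgal) sxy qy.
have sr : size r = 2%N.
  rewrite -(size_map_poly iota) rE size_Mmonic ?monicXsubC // size_XsubC.
  by apply/eqP; rewrite addn2 /= eqSS eqn_leq sq size_poly_gt0.
have r1 : r`_1 != 0 by move: rN0; rewrite -lead_coef_eq0 lead_coefE sr.
move: rx; rewrite /root (horner_coef_wide _ (n := 2)) ?size_map_poly ?sr //.
rewrite big_ord_recl big_ord1 /= !coef_map expr0 mulr1 expr1 addr_eq0 => /eqP E.
exists (- r`_0 / r`_1); rewrite fmorph_div rmorphN E opprK mulrC mulKf //.
by rewrite fmorph_eq0.
Qed.

End SeparableClosure.

(** * Invariant forms and rational orbits *)

Lemma disc_scale (R : comNzRingType) n c (A : 'M[R]_n) :
  disc (c *: A) = c ^+ n * disc A.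
Proof. by rewrite /disc detZ mulrCA. Qed.

Lemma disc_mulmx (R : comNzRingType) n (A B : 'M[R]_n) :
  disc (A *m B) = \det A * disc B.
Proof. by rewrite /disc det_mulmx mulrCA. Qed.

Lemma disc_map (R S : comNzRingType) (s : {rmorphism R -> S}) n (A : 'M[R]_n) :
  disc (map_mx s A) = s (disc A).
Proof. by rewrite /disc det_map_mx rmorphM rmorphXn rmorphN1. Qed.

Section InvForm.
Variables (R S : comNzRingType) (n : nat).
Variable rho : {rmorphism {poly {poly R}} -> S}.

Lemma rmorph_inv_form (v : 'M[R]_n * 'M[R]_n) :
  rho (inv_form v) =
  disc (rho 'X *: map_mx (fun c => rho c%:P%:P) v.1
        - rho 'Y *: map_mx (fun c => rho c%:P%:P) v.2).
Proof.
rewrite /inv_form -disc_map; congr disc.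
by apply/matrixP => i l; rewrite !mxE rmorphB !rmorphM.
Qed.

Lemma rmorph_bform (f : 'I_n.+1 -> R) :
  rho (bform f) = beval (fun i => rho (f i)%:P%:P) (rho 'X) (rho 'Y).
Proof.
rewrite /bform /beval rmorph_sum; apply: eq_bigr => i _.
by rewrite !rmorphM !rmorphXn.
Qed.

End InvForm.

Lemma beval_homog (R : comNzRingType) n (f : 'I_n.+1 -> R) x y :
  beval f (x * y) y = y ^+ n * beval f x 1.
Proof.
rewrite /beval big_distrr /=; apply: eq_bigr => i _.
rewrite expr1n mulr1 exprMn -!mulrA -exprD subnK 1?mulrA; last by rewrite -ltnS.
by rewrite mulrC mulrA.
Qed.

Lemma beval0r (R : comNzRingType) n (f : 'I_n.+1 -> R) x :
  beval f x 0 = f ord0 * x ^+ n.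
Proof.
rewrite /beval big_ord_recl expr0 mulr1 subn0 big1 ?addr0 // => i _.
by rewrite exprS mul0r mulr0.
Qed.

(* The substitution x := x * y is injective and turns both sides into y^n times
   their dehomogenizations. *)
Lemma inv_form_dehom (K : fieldType) n (v : 'M[K]_n * 'M[K]_n)
    (f : 'I_n.+1 -> K) :
  inv_form v = bform f <->
  disc ('X *: map_mx (@polyC K) v.1 - map_mx (@polyC K) v.2) = dehom f.
Proof.
pose XY : {poly {poly K}} := 'X * 'Y.
pose rho : {rmorphism {poly {poly K}} -> {poly {poly K}}} := comp_poly XY.
have rhoC c : rho c%:P%:P = c%:P%:P by rewrite /rho /= comp_polyC.
have rhoX : rho 'X = 'X * 'Y by rewrite /rho /= comp_polyX.
have rhoY : rho 'Y = 'Y by rewrite /rho /= comp_polyC.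
have YN0 : 'Y != 0 :> {poly {poly K}} by rewrite polyC_eq0 polyX_eq0.
have rho_inj : injective rho.
  move=> p q /eqP; rewrite -subr_eq0 -rmorphB /rho /= comp_poly_eq0 ?subr_eq0.
    by move/eqP.
  by rewrite /XY size_mul ?polyX_eq0 // size_polyX size_polyC polyX_eq0.
have rho_inv : rho (inv_form v) = 'Y ^+ n *
    (disc ('X *: map_mx (@polyC K) v.1 - map_mx (@polyC K) v.2))^:P.
  rewrite rmorph_inv_form rhoX rhoY -disc_map -disc_scale; congr disc.
  apply/matrixP => i l; rewrite !mxE !rhoC rmorphB rmorphM /= !map_polyC map_polyX /=.
  by rewrite mulrBr mulrCA mulrA.
have rho_f : rho (bform f) = 'Y ^+ n * (dehom f)^:P.
  rewrite rmorph_bform rhoX rhoY beval_homog; congr (_ * _).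
  rewrite /dehom /beval rmorph_sum; apply: eq_bigr => i _.
  by rewrite rhoC !rmorphM !rmorphXn /= map_polyC map_polyX /= rmorph1.
split=> [E|E]; last by apply: rho_inj; rewrite rho_inv rho_f E.
have : rho (inv_form v) = rho (bform f) by rewrite E.
rewrite rho_inv rho_f => /(mulfI (expf_neq0 n YN0)).
by apply: map_inj_poly => //; apply: polyC_inj.
Qed.

Lemma char_poly_disc (K : fieldType) n (A B : 'M[K]_n) : A \in unitmx ->
  disc ('X *: map_mx (@polyC K) A - map_mx (@polyC K) B) =
  disc A *: char_poly (B *m invmx A).
Proof.
move=> AU; have -> : 'X *: map_mx (@polyC K) A - map_mx (@polyC K) B =
    char_poly_mx (B *m invmx A) *m map_mx (@polyC K) A.
  rewrite /char_poly_mx mulmxBl mul_scalar_mx map_mxM /= -mulmxA -map_mxM.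
  by rewrite mulVmx // map_mx1 mulmx1.
by rewrite disc_mulmx disc_map /= mulrC mul_polyC.
Qed.

Lemma disc_unitmx (K : fieldType) n (A : 'M[K]_n) : (A \in unitmx) = (disc A != 0).
Proof. by rewrite /disc unitmxE unitfE mulf_eq0 signr_eq0. Qed.

(** Putting y = 0 gives disc A = f_0, so [A] is invertible and the dehomogenized form is f_0 times
    the characteristic polynomial of B A^-1. *)
Lemma VfP (K : fieldType) n (f : 'I_n.+1 -> K) (g : {poly K})
    (v : 'M[K]_n * 'M[K]_n) :
  f ord0 != 0 -> dehom f = f ord0 *: g ->
  Vf f v <-> [/\ v.1^T = v.1, v.2^T = v.2, disc v.1 = f ord0 &
                 char_poly (v.2 *m invmx v.1) = g].
Proof.
move=> f0 fg; split=> [[[As Bs] fE]|[As Bs dA Sg]]; last first.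
  split=> //; apply/inv_form_dehom.
  by rewrite char_poly_disc ?disc_unitmx dA // Sg fg.
have dA : disc v.1 = f ord0.
  pose rho : {rmorphism {poly {poly K}} -> {poly K}} :=
    map_poly (horner_eval (0 : K)).
  have rhoC c : rho c%:P%:P = c%:P.
    by rewrite /rho /= map_polyC /= /horner_eval hornerC.
  have rhoX : rho 'X = 'X by rewrite /rho /= map_polyX.
  have rhoY : rho 'Y = 0.
    by rewrite /rho /= map_polyC /= /horner_eval hornerX.
  clearbody rho.
  have : rho (inv_form v) = rho (bform f) by rewrite fE.
  rewrite (rmorph_inv_form rho v) (rmorph_bform rho f) rhoX rhoY scale0r subr0.
  rewrite disc_scale.
  have -> : map_mx (fun c => rho c%:P%:P) v.1 = map_mx (@polyC K) v.1.
    by apply/matrixP => i l; rewrite !mxE rhoC.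
  rewrite disc_map beval0r rhoC mulrC => /mulIf E.
  by apply: polyC_inj; apply: E; rewrite expf_neq0 ?polyX_eq0.
split=> //; move/inv_form_dehom: fE; rewrite char_poly_disc ?disc_unitmx dA //.
by rewrite fg => /(scalerI f0).
Qed.

Section RationalOrbits.
Variables (k ks : fieldType) (iota : {rmorphism k -> ks}).
Hypotheses (hk : 2%N \notin [pchar k]) (hks : is_separable_closure iota).

Lemma ks_sqrt (d : ks) : exists e, e ^+ 2 = d.
Proof.
have [->|dN0] := eqVneq d 0; first by exists 0; rewrite expr0n.
have two : 2%:R != 0 :> ks.
  by move: hk; rewrite -(fmorph_pchar iota) inE /=.
have [||e] := hks.2 ('X^2 - d%:P).
- rewrite separable_poly.unlock derivB derivC subr0 derivXn expr1 -scaler_nat.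
  rewrite coprimepZr // coprimepX /root !hornerE expr0n /= sub0r oppr_eq0.
  exact: dN0.
- by rewrite size_XnsubC.
- by rewrite /root !hornerE subr_eq0 => /eqP; exists e.
Qed.

Lemma act_mulmx (R : comNzRingType) n (g h : 'M[R]_n) v :
  act (g *m h) v = act h (act g v).
Proof. by rewrite /act /= trmx_mul !mulmxA. Qed.

Lemma act1 (R : comNzRingType) n (v : 'M[R]_n * 'M[R]_n) : act 1%:M v = v.
Proof. by case: v => A B; rewrite /act /= trmx1 !mul1mx !mulmx1. Qed.

Lemma act_scalel (R : comNzRingType) n c (g : 'M[R]_n) v :
  act (c *: g) v = ((c ^+ 2) *: (act g v).1, (c ^+ 2) *: (act g v).2).
Proof.
rewrite /act /= [(c *: g)^T]linearZ /= -!scalemxAr -!scalemxAl -?scalemxAr.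
by rewrite !scalerA expr2.
Qed.

(** The action of [e *: g] for a square root [e] of [d], expressed over k: for even n its
    determinant is [d ^+ n./2 * \det g], and [act] is quadratic in [e]. *)
Definition rat_act n (v w : 'M[k]_n * 'M[k]_n) :=
  exists (d : k) (g : 'M[k]_n),
    [/\ d != 0, d ^+ n./2 * \det g = 1, d *: (act g v).1 = w.1 &
        d *: (act g v).2 = w.2].

Lemma map_V_act n (g : 'M[k]_n) v :
  map_V iota (act g v) = act (map_mx iota g) (map_V iota v).
Proof. by rewrite /map_V /act /= !map_mxM !map_trmx. Qed.

(* A Galois-stable class ±g is e *: g0 with g0 rational and e^2 = d in k: take
   for e any nonzero entry of g. *)
Lemma orbitP n (v w : 'M[k]_n * 'M[k]_n) : (0 < n)%N -> ~~ odd n ->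
  Defs.orbit iota v w <-> rat_act v w.
Proof.
move=> n0 nev; have nE : n = (2 * n./2)%N.
  by rewrite mul2n; have := odd_double_half n; rewrite (negPf nev) add0n.
split=> [[_ [[g /= dg <-] gal]]|[d [g [dN0 dg E1 E2]]]]; last first.
  have [e eE] := ks_sqrt (iota d).
  exists (\pi_(modpm 'M[ks]_n) (e *: map_mx iota g))%qT; last first.
    rewrite hactE act_scalel -map_V_act eE /map_V /=.
    by rewrite -!map_mxZ E1 E2.
  split.
    exists (e *: map_mx iota g) => //=.
    by rewrite detZ det_map_mx {1}nE exprM eE -rmorphXn -rmorphM dg rmorph1.
  move=> s [_ sk]; rewrite hgalE; apply/eqP/pm_piP.
  have : (s e) ^+ 2 = e ^+ 2 by rewrite -rmorphXn eE sk.
  have sg : map_mx s (map_mx iota g) = map_mx iota g.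
    by apply/matrixP => i l; rewrite !mxE sk.
  move/eqP; rewrite eqf_sqr map_mxZ sg => /orP[]/eqP->; first by left.
  by right; rewrite scaleNr opprK.
rewrite hactE => E.
have galg s : is_gal iota s -> map_mx s g = g \/ map_mx s g = - g.
  move=> /gal; rewrite hgalE => /eqP/pm_piP[<-|gs]; [by left|right].
  by rewrite [in RHS]gs opprK.
have [i [l eN0]] : exists i l, g i l != 0.
  apply: contrapT => H; have g0 : g = 0.
    apply/matrixP => i l; rewrite mxE; apply/eqP/negPn/negP => gil.
    by apply: H; exists i, l.
  move: dg; rewrite g0 (expand_det_row _ (Ordinal n0)) big1 => [|l _].
    by move/esym/eqP; rewrite oner_eq0.
  by rewrite mxE mul0r.
set e := g i l in eN0.
have [d dE] : exists d, e ^+ 2 = iota d.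
  apply: (gal_fixed hks) => s /galg[] /matrixP/(_ i l); rewrite !mxE rmorphXn /= => ->.
    by [].
  by rewrite sqrrN.
(* An automorphism multiplies all entries of [g] by the same sign, which cancels in the quotients by
   [e]. *)
have /choice[g0 g0E] : forall il : 'I_n * 'I_n, exists c, g il.1 il.2 / e = iota c.
  move=> il; apply: (gal_fixed hks) => s /galg[] /matrixP sg;
  by have := sg i l; have := sg il.1 il.2; rewrite !mxE fmorph_div => -> ->;
     rewrite ?invrN ?mulrNN.
pose h : 'M[k]_n := \matrix_(a, b) g0 (a, b).
have gE : g = e *: map_mx iota h.
  by apply/matrixP => a b; rewrite !mxE -g0E /= mulrC divfK.
have dN0 : d != 0 by rewrite -(fmorph_eq0 iota) -dE expf_neq0.
exists d, h; split=> //.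
- apply: (fmorph_inj iota); rewrite rmorphM rmorphXn -dE -exprM -nE rmorph1.
  by rewrite -det_map_mx -detZ -gE.
- move: E; rewrite gE act_scalel -map_V_act dE => -[/esym E _].
  by move: E; rewrite -map_mxZ => /map_mx_inj.
- move: E; rewrite gE act_scalel -map_V_act dE => -[_ /esym E].
  by move: E; rewrite -map_mxZ => /map_mx_inj.
Qed.

Lemma rat_act_refl n (v : 'M[k]_n * 'M[k]_n) : rat_act v v.
Proof.
by exists 1, 1%:M; rewrite act1 !scale1r expr1n det1 mulr1 oner_neq0.
Qed.

Lemma rat_act_trans n (u v w : 'M[k]_n * 'M[k]_n) :
  rat_act u v -> rat_act v w -> rat_act u w.
Proof.
move=> [d [g [dN0 dg E1 E2]]] [d' [g' [dN0' dg' E1' E2']]].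
exists (d * d'), (g *m g'); split; first by rewrite mulf_neq0.
- by rewrite exprMn det_mulmx mulrACA dg dg' mulr1.
- rewrite -E1' act_mulmx /= -E1 -!scalemxAr -!scalemxAl -?scalemxAr scalerA.
  by rewrite mulrC.
- rewrite -E2' act_mulmx /= -E2 -!scalemxAr -!scalemxAl -?scalemxAr scalerA.
  by rewrite mulrC.
Qed.

Lemma rat_act_sym n (v w : 'M[k]_n * 'M[k]_n) : rat_act v w -> rat_act w v.
Proof.
move=> [d [g [dN0 dg E1 E2]]].
have gU : g \in unitmx.
  rewrite unitmxE unitfE; apply: contra_eq_neq dg => ->.
  by rewrite mulr0 eq_sym oner_neq0.
exists d^-1, (invmx g); split; first by rewrite invr_eq0.
- by rewrite det_inv exprVn -invfM dg invr1.
- rewrite /act /= -E1 /= -!scalemxAr -!scalemxAl -?scalemxAr scalerA mulVf // scale1r.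
  by rewrite -!mulmxA mulmxV // mulmx1 !mulmxA -trmx_mul mulmxV // trmx1 mul1mx.
- rewrite /act /= -E2 /= -!scalemxAr -!scalemxAl -?scalemxAr scalerA mulVf // scale1r.
  by rewrite -!mulmxA mulmxV // mulmx1 !mulmxA -trmx_mul mulmxV // trmx1 mul1mx.
Qed.

End RationalOrbits.

(** * Pairs of forms and elements of L *)

Lemma disc_congr (R : comNzRingType) n (D A : 'M[R]_n) :
  disc (D *m A *m D^T) = \det D ^+ 2 * disc A.
Proof. by rewrite /disc !det_mulmx det_tr expr2 [RHS]mulrCA [_ * _ * \det D]mulrAC. Qed.

Lemma sym_congr (R : comNzRingType) n (D A : 'M[R]_n) :
  A^T = A -> (D *m A *m D^T)^T = D *m A *m D^T.
Proof. by move=> As; rewrite !trmx_mul trmxK As mulmxA. Qed.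

Lemma char_poly_conj (R : comUnitRingType) n (P S : 'M[R]_n) : P \in unitmx ->
  char_poly (invmx P *m S *m P) = char_poly S.
Proof.
move=> PU; rewrite /char_poly.
have -> : char_poly_mx (invmx P *m S *m P) = map_mx (@polyC R) (invmx P) *m
    char_poly_mx S *m map_mx (@polyC R) P.
  rewrite /char_poly_mx mulmxBr mulmxBl -!map_mxM /=; congr (_ - _).
  by rewrite scalar_mxC -mulmxA -map_mxM mulVmx // map_mx1 mulmx1.
rewrite !det_mulmx mulrAC -det_mulmx -map_mxM mulVmx //.
by rewrite map_mx1 det1 mul1r.
Qed.

Section Correspondence.
Variables (K F : fieldType) (j : {rmorphism K -> F}) (n' : nat) (h : {poly K}).
Local Notation n := n'.+1.
Hypotheses (hm : h \is monic) (sh : size h = n.+1).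
Variable rs : seq F.
Hypotheses (hE : map_poly j h = \prod_(r <- rs) ('X - r%:P)) (rsU : uniq rs).
Variable f0 : K.
Hypothesis f0N0 : f0 != 0.
Local Notation C := (compmx n h).
Local Notation J := (gramJ n' h).

Definition is_vec (v : 'M[K]_n * 'M[K]_n) :=
  [/\ v.1^T = v.1, v.2^T = v.2, disc v.1 = f0 &
      char_poly (v.2 *m invmx v.1) = h].

(* In the basis 1, x, ..., x^(n-1) of L, the matrices a(C) J and C a(C) J are
   the Gram matrices of (l, m) |-> tau(a l m) and tau(x a l m), where tau is the
   coefficient of x^(n-1). *)
Definition normal_form (v : 'M[K]_n * 'M[K]_n) (u : {poly %/ h} * K) :=
  exists2 D : 'M[K]_n, D \in unitmx &
    [/\ D *m v.1 *m D^T = horner_mx C u.1 *m J,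
        D *m v.2 *m D^T = C *m (horner_mx C u.1 *m J) & u.2 = f0 * \det D].

Lemma tr_gram q : (horner_mx C q *m J)^T = horner_mx C q *m J.
Proof. by rewrite trmx_mul gramJ_sym // horner_gramJ. Qed.

Lemma mul_compmx_horner q : C *m horner_mx C q = horner_mx C ('X * q).
Proof. by rewrite rmorphM /= horner_mx_X. Qed.

(** Put G = D A D^T with [D] conjugating B A^-1 to [C]. Symmetry of [G] and of [C *m G] shows that G
    J^-1 commutes with [C], so it is some a(C). Taking [disc] of G = a(C) J gives N(a) = f_0
    det(D)^2. *)
Lemma normal_form_exists v : is_vec v ->
  exists2 u, pairs h f0 u & normal_form v u.
Proof.
case: v => A B [/= As Bs dA Sh].
have AU : A \in unitmx by rewrite disc_unitmx dA.
have JU := unit_gramJ n' h.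
have [D DU DS] := similar_compmx hm sh hE rsU Sh.
pose G := D *m A *m D^T.
have GB : D *m B *m D^T = C *m G.
  by rewrite /G !mulmxA -DS -!mulmxA (mulmxA (invmx A)) mulVmx // mul1mx.
have GC : C *m G = G *m C^T.
  have Gs : G^T = G by apply: sym_congr.
  by rewrite -{2}Gs -trmx_mul -GB sym_congr.
have JC : invmx J *m C = C^T *m invmx J.
  by apply: (canRL (mulmxK JU)); rewrite -mulmxA compmx_gramJ // mulKmx.
have [a aE] : exists a : {poly %/ h}, G *m invmx J = horner_mx C a.
  apply: comm_compmx_qpoly => //.
  by rewrite -mulmxA JC mulmxA -GC -mulmxA.
have GE : G = horner_mx C a *m J by rewrite -aE mulmxKV.
have nE : qnorm a = \det D ^+ 2 * f0.
  rewrite -dA -disc_congr -/G GE disc_mulmx disc_gramJ mulr1.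
  by rewrite (qnormE hm sh).
have dN0 : \det D != 0 by rewrite -unitfE -unitmxE.
exists (a, f0 * \det D).
  split=> /=; first by rewrite (qpoly_unitE hm sh) nE mulf_neq0 ?expf_neq0.
    by rewrite mulf_neq0.
  by rewrite nE exprMn mulrCA mulrC expr2.
by exists D => //; split=> //=; rewrite GB GE.
Qed.

Lemma vec_exists u : pairs h f0 u -> exists2 v, is_vec v & normal_form v u.
Proof.
case: u => a t [/= aU tN0 aE].
have JU := unit_gramJ n' h.
(* Any [D] of determinant t / f_0 would do; [A] and [B] are then read off from the normal form. *)
pose d : 'rV[K]_n := \row_i (if i == ord0 then t / f0 else 1).
pose D := diag_mx d.
have dD : \det D = t / f0.
  rewrite det_diag (bigD1 ord0) //= mxE eqxx big1 ?mulr1 // => i iN.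
  by rewrite mxE (negPf iN).
have DU : D \in unitmx by rewrite unitmxE unitfE dD mulf_neq0 ?invr_eq0.
have aCU : horner_mx C a \in unitmx.
  by rewrite unitmxE -(qnormE hm sh) unitfE -(qpoly_unitE hm sh).
pose G := horner_mx C a *m J.
have GU : G \in unitmx by rewrite unitmx_mul aCU.
pose D' := invmx D; have D'U : D' \in unitmx by rewrite unitmx_inv.
have D'tU : D'^T \in unitmx by rewrite unitmx_tr.
have DD' X : D *m (D' *m X *m D'^T) *m D^T = X.
  rewrite !mulmxA mulmxV // mul1mx -mulmxA -trmx_mul mulmxV //.
  by rewrite trmx1 mulmx1.
pose A := D' *m G *m D'^T; pose B := D' *m (C *m G) *m D'^T.
have AU : A \in unitmx by rewrite unitmx_mul D'tU andbT unitmx_mul D'U.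
exists (A, B); last first.
  exists D => //; split=> /=; rewrite ?DD' //.
  by rewrite dD mulrC divfK.
split=> /=.
- exact/sym_congr/tr_gram.
- by apply: sym_congr; rewrite /G mulmxA mul_compmx_horner tr_gram.
- rewrite disc_congr disc_mulmx disc_gramJ // mulr1 -(qnormE hm sh) det_inv dD.
  have -> : qnorm a = t ^+ 2 / f0 by rewrite -aE mulrC mulKf.
  rewrite invf_div expr_div_n mulrA divfK ?expf_neq0 //.
  by rewrite expr2 mulfK.
have -> : B *m invmx A = invmx D *m C *m D.
  apply: (canLR (mulmxK AU)).
  have DA : D *m A = G *m D'^T by rewrite /A -mulmxA mulKVmx.
  by rewrite -(mulmxA _ D) DA /B -!mulmxA.
by rewrite char_poly_conj // char_poly_compmx.
Qed.

(** Since c(C) is self-adjoint for [J], congruence by c(C) multiplies the parameter a by c^2. *)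
Lemma gram_congr (a c : {poly %/ h}) d (P := horner_mx C c) :
  d *: (P *m (horner_mx C a *m J) *m P^T) =
  horner_mx C (d *: (c ^+ 2 * a) : {poly %/ h}) *m J.
Proof.
have PJ : P *m J = J *m P^T by apply: horner_gramJ.
have -> : horner_mx C (d *: (c ^+ 2 * a) : {poly %/ h}) =
    d *: (P *m P *m horner_mx C a).
  rewrite -!(horner_qpolyM hm sh (char_poly_compmx hm sh)) -expr2.
  by rewrite -horner_mxZ.
rewrite -scalemxAl; congr (_ *: _); rewrite -mulmxA -(mulmxA _ J) -PJ.
have -> : horner_mx C a *m (P *m J) = P *m (horner_mx C a *m J).
  by rewrite !mulmxA; congr (_ *m _); apply: comm_horner_mx2.
by rewrite !mulmxA.
Qed.

(** The base changes are linked by D'^-1 c(C) D, transposed because [act] has [g^T] on the left. The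
    case d = 1 later gives transitivity over ks. *)
Lemma normal_form_transport v w u z c d :
  normal_form v u -> normal_form w z ->
  d *: (c ^+ 2 * u.1) = z.1 -> qnorm c * d ^+ n./2 * u.2 = z.2 ->
  exists g : 'M[K]_n, [/\ d ^+ n./2 * \det g = 1, d *: (act g v).1 = w.1 &
                          d *: (act g v).2 = w.2].
Proof.
case: v w u z => [A B] [A' B'] [a t] [a' t'] [D DU [/= DA DB tE]].
move=> [D' D'U [/= D'A D'B t'E]] aE Nc.
pose P := horner_mx C c; pose G := invmx D' *m P *m D.
have PC : P *m C = C *m P by apply: comm_horner_mx.
have cE : d *: (P *m (horner_mx C a *m J) *m P^T) = horner_mx C a' *m J.
  by rewrite gram_congr aE.
have conj X Y : D' *m X *m D'^T = Y -> X = invmx D' *m Y *m (invmx D')^T.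
  move=> <-; rewrite !mulmxA mulVmx // mul1mx -mulmxA -trmx_mul.
  by rewrite mulVmx // trmx1 mulmx1.
exists G^T; split.
- have dDN0 : \det D' != 0 by rewrite -unitfE -unitmxE.
  have E : qnorm c * d ^+ n./2 * \det D = \det D'.
    by apply: (mulfI f0N0); rewrite -t'E -Nc tE mulrCA.
  rewrite det_tr !det_mulmx det_inv -(qnormE hm sh) -mulrA mulrCA.
  by rewrite [d ^+ _ * _]mulrCA [qnorm c * _]mulrA E mulVf.
- rewrite /= trmxK (conj _ _ D'A) -cE -DA /G !trmx_mul.
  by rewrite -!scalemxAr -!scalemxAl !mulmxA.
- rewrite /= trmxK (conj _ _ D'B) -cE /G !trmx_mul -!scalemxAr -!scalemxAl.
  congr (_ *: _); rewrite !mulmxA -(mulmxA _ C P) -PC.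
  rewrite [in RHS](mulmxA _ P C) -(mulmxA _ _ J) -(mulmxA _ C) -DB.
  by rewrite !mulmxA.
Qed.

(** The matrix P = D' g^T D^-1 carries both Gram matrices of [v] to those of [w], up to [d].
    Comparing the two equations shows that [P] commutes with [C], so P = c(C). *)
Lemma normal_form_equiv v w u z :
  normal_form v u -> normal_form w z -> u.1 \is a GRing.unit ->
  rat_act v w -> pair_equiv n z u.
Proof.
case: v w u z => [A B] [A' B'] [a t] [a' t'] [D DU [/= DA DB tE]].
move=> [D' D'U [/= D'A D'B t'E]] aU [d [g [dN0 dg /= Ag Bg]]].
have gU : g \in unitmx.
  rewrite unitmxE unitfE; apply: contra_eq_neq dg => ->.
  by rewrite mulr0 eq_sym oner_neq0.
pose P := D' *m g^T *m invmx D.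
have PU : P \in unitmx by rewrite !unitmx_mul D'U unitmx_tr gU unitmx_inv DU.
have PtU : P^T \in unitmx by rewrite unitmx_tr.
have PD : P *m D = D' *m g^T by rewrite mulmxKV.
have conj X Y : D *m X *m D^T = Y ->
    D' *m (d *: (g^T *m X *m g)) *m D'^T = d *: (P *m Y *m P^T).
  move=> <-; rewrite -!scalemxAr -!scalemxAl; congr (_ *: _).
  rewrite !mulmxA PD -!mulmxA; congr (_ *m (_ *m (_ *m _))).
  by rewrite -trmx_mul PD trmx_mul trmxK.
have E1 : d *: (P *m (horner_mx C a *m J) *m P^T) = horner_mx C a' *m J.
  by rewrite -(conj _ _ DA) Ag.
have E2 : d *: (P *m (C *m (horner_mx C a *m J)) *m P^T) =
    C *m (horner_mx C a' *m J).
  by rewrite -(conj _ _ DB) Bg.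
have aJU : horner_mx C a *m J \in unitmx.
  by rewrite unitmx_mul unit_gramJ andbT unitmxE -(qnormE hm sh) unitfE
    -(qpoly_unitE hm sh).
have PC : P *m C = C *m P.
  move: E2; rewrite -E1 -scalemxAr => /(scalerI dN0); rewrite !mulmxA.
  move/(can_inj (mulmxK PtU)).
  by rewrite -!(mulmxA _ (horner_mx C a)) => /(can_inj (mulmxK aJU)).
have [c cE] := comm_compmx_qpoly hm sh PC.
have cN0 : qnorm c != 0 by rewrite (qnormE hm sh) -cE -unitfE -unitmxE.
exists c, d; split=> //=; first by rewrite (qpoly_unitE hm sh).
  apply: (horner_qpoly_inj hm sh).
  apply: (can_inj (mulmxK (unit_gramJ n' h))).
  by rewrite -E1 cE gram_congr.
rewrite (qnormE hm sh) -cE tE t'E mulrCA; congr (_ * _).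
by rewrite mulrAC -det_mulmx PD det_mulmx det_tr -mulrA [_ * d ^+ _]mulrC dg mulr1.
Qed.

End Correspondence.

(** * Stabilizers *)

Section SplitAlgebra.
Variables (K : fieldType) (n' : nat) (h : {poly K}).
Local Notation n := n'.+1.
Hypotheses (hm : h \is monic) (sh : size h = n.+1).
Variable r : 'I_n -> K.
Hypotheses (hr : h = \prod_(i < n) ('X - (r i)%:P)) (rI : injective r).

Local Notation V := (Vandermonde n (\row_i r i)).

Lemma unit_Vandermonde : V \in unitmx.
Proof.
rewrite unitmxE unitfE det_Vandermonde; apply/prodf_neq0 => i _.
apply/prodf_neq0 => l il; rewrite !mxE subr_eq0.
by apply: contraTneq il => /rI ->; rewrite ltnn.
Qed.

Lemma horner_Vandermonde (q : {poly K}) i : (size q <= n)%N ->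
  q.[r i] = (poly_rV q *m V) 0 i.
Proof.
move=> sq; rewrite (horner_coef_wide _ sq) mxE; apply: eq_bigr => l _.
by rewrite !mxE.
Qed.

Lemma qpoly_eval_inj (a b : {poly %/ h}) :
  (forall i, a.[r i] = b.[r i]) -> a = b.
Proof.
move=> E; apply: val_inj; rewrite /= -(poly_rV_K (size_qpoly hm sh a)).
rewrite -(poly_rV_K (size_qpoly hm sh b)); congr rVpoly.
apply: (can_inj (mulmxK unit_Vandermonde)); apply/rowP => i.
by rewrite -!horner_Vandermonde ?size_qpoly.
Qed.

Lemma qpoly_interp (b : 'I_n -> K) :
  exists a : {poly %/ h}, forall i, a.[r i] = b i.
Proof.
pose q := rVpoly ((\row_i b i) *m invmx V).
have sq : (size q <= n)%N by apply: size_poly.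
exists (in_qpoly h q) => i.
rewrite in_qpoly_small; last by rewrite (mk_monicE hm sh) sh ltnS.
by rewrite horner_Vandermonde // rVpolyK mulmxKV ?unit_Vandermonde // mxE.
Qed.

Lemma eval_in_qpoly q i : (in_qpoly h q).[r i] = q.[r i].
Proof.
have h0 : h.[r i] = 0.
  by rewrite hr horner_prod (bigD1 i) //= hornerXsubC subrr mul0r.
rewrite (in_qpolyE hm sh) {2}(divp_eq q h) hornerD hornerM h0 mulr0 add0r //.
Qed.

Lemma eval_qpolyM (a b : {poly %/ h}) i :
  (a * b : {poly %/ h}).[r i] = a.[r i] * b.[r i].
Proof.
by rewrite -[a in LHS]in_qpolyK -[b in LHS]in_qpolyK -rmorphM eval_in_qpoly hornerM.
Qed.

Lemma eval_qpoly1 i : (1 : {poly %/ h}).[r i] = 1.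
Proof. by rewrite -(rmorph1 (in_qpoly h)) eval_in_qpoly hornerC. Qed.

(** The Vandermonde matrix diagonalizes a(C), with eigenvalues a(r_i). *)
Lemma qnorm_prod (a : {poly %/ h}) : qnorm a = \prod_i a.[r i].
Proof.
rewrite (qnormE hm sh).
have E : horner_mx (compmx n h) a *m V = V *m diag_mx (\row_i a.[r i]).
  apply/row_matrixP => l; apply/rowP => i.
  rewrite row_mul row_horner_compmx // -(horner_in_qpoly hm sh (char_poly_compmx hm sh)).
  rewrite delta_horner_compmx ?(size_qpoly hm sh) //.
  rewrite -horner_Vandermonde ?(size_qpoly hm sh) // eval_in_qpoly.
  by rewrite mul_mx_diag !mxE hornerM hornerXn mulrC.
have := congr1 determinant E; rewrite !det_mulmx det_diag mulrC.
move/mulfI => ->; last by rewrite -unitfE -unitmxE unit_Vandermonde.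
by apply: eq_bigr => i _; rewrite mxE.
Qed.

Lemma qpoly_sqrt (a : {poly %/ h}) : (forall x : K, exists y, y ^+ 2 = x) ->
  exists c : {poly %/ h}, c ^+ 2 = a.
Proof.
move=> sq; have /choice[b bE] : forall i, exists y, y ^+ 2 = a.[r i].
  by move=> i; apply: sq.
have [c cE] := qpoly_interp b; exists c; apply: qpoly_eval_inj => i.
by rewrite expr2 eval_qpolyM !cE -expr2.
Qed.

(** The element takes the value -1 at one root and 1 at the others. Multiplying by it corrects the
    sign of a norm when two vectors are compared over ks. *)
Lemma qpoly_norm_N1 : exists2 c : {poly %/ h}, c ^+ 2 = 1 & qnorm c = -1.
Proof.
have [c cE] := qpoly_interp (fun i => if i == ord0 then -1 else 1).
exists c.
  apply: qpoly_eval_inj => i; rewrite expr2 eval_qpolyM eval_qpoly1 cE.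
  by case: ifP; rewrite ?mulrNN mulr1.
rewrite qnorm_prod (bigD1 ord0) //= cE eqxx big1 ?mulr1 // => i iN.
by rewrite cE (negPf iN).
Qed.

End SplitAlgebra.

(** * The stabilizer of one vector *)

Section Stabilizer.
Variables (K F : fieldType) (j : {rmorphism K -> F}) (n' : nat) (h : {poly K}).
Local Notation n := n'.+1.
Hypotheses (hm : h \is monic) (sh : size h = n.+1).
Variable rs : seq F.
Hypotheses (hE : map_poly j h = \prod_(r <- rs) ('X - r%:P)) (rsU : uniq rs).
Variable f0 : K.
Hypothesis f0N0 : f0 != 0.
Variable v : 'M[K]_n * 'M[K]_n.
Hypothesis vP : is_vec h f0 v.
Local Notation A := v.1.
Local Notation B := v.2.
(** [A] and [B] being symmetric, this is the transpose of B A^-1; it is the operator that commutes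
    with the stabilizing matrices. *)
Definition adjoint_mx := invmx A *m B.
Local Notation T := adjoint_mx.

Lemma unit_vec1 : A \in unitmx.
Proof. by case: vP => _ _ dA _; rewrite disc_unitmx dA. Qed.

Lemma vec2E : B = A *m T.
Proof. by rewrite mulKVmx ?unit_vec1. Qed.

Lemma char_poly_adjoint : char_poly T = h.
Proof.
case: vP => _ _ _ <-; rewrite -(char_poly_conj (B *m invmx A) unit_vec1).
by rewrite mulmxA mulmxKV ?unit_vec1.
Qed.
Local Notation cT := char_poly_adjoint.

Lemma adjointP : T^T *m A = A *m T.
Proof.
by case: vP => As Bs _ _; rewrite -vec2E -[in LHS]As -trmx_mul -vec2E.
Qed.

Lemma horner_adjoint q : (horner_mx T q)^T *m A = A *m horner_mx T q.
Proof.
elim/poly_ind: q => [|q c IH]; first by rewrite rmorph0 trmx0 mul0mx mulmx0.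
rewrite rmorphD rmorphM /= horner_mx_C horner_mx_X.
rewrite -[_ * T]/(_ *m T) linearD /= trmx_mul tr_scalar_mx mulmxDl mulmxDr.
rewrite -scalar_mxC; congr (_ + _).
rewrite -mulmxA IH mulmxA adjointP -(mulmxA A); congr (_ *m _).
by apply: commr_sym; apply: comm_horner_mx.
Qed.

(** Conjugation by [E] transports to [T] what is known for the companion matrix: its commutant,
    injectivity of a |-> a(T), and det a(T) = N(a). *)
Lemma adjoint_similar : exists2 E : 'M[K]_n, E \in unitmx &
  forall q, horner_mx T q = invmx E *m horner_mx (compmx n h) q *m E.
Proof.
have [E EU ET] := similar_compmx hm sh hE rsU cT; exists E => // q.
have -> : T = invmx E *m compmx n h *m E by rewrite -mulmxA -ET mulKmx.
by rewrite horner_mx_uconjC.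
Qed.

Lemma comm_adjoint X : X *m T = T *m X ->
  exists a : {poly %/ h}, X = horner_mx T a.
Proof.
have [E EU hT] := adjoint_similar.
have TE : T = invmx E *m compmx n h *m E.
  by rewrite -[LHS]horner_mx_X hT horner_mx_X.
move: (T) hT TE => T0 hT TE XT.
have [|a aE] := @comm_compmx_qpoly _ _ _ hm sh (E *m X *m invmx E).
  have CE : compmx n h = E *m T0 *m invmx E.
    by rewrite TE -!mulmxA mulmxV // mulmx1 mulKVmx.
  rewrite CE -!mulmxA !(mulmxA (invmx E)) mulVmx // !mul1mx.
  by rewrite (mulmxA X) XT !mulmxA.
by exists a; rewrite hT -aE -!mulmxA mulVmx // mulmx1 mulKmx.
Qed.

Lemma horner_adjoint_inj (a b : {poly %/ h}) :
  horner_mx T a = horner_mx T b -> a = b.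
Proof.
have [E EU hT] := adjoint_similar; rewrite !hT => /(can_inj (mulmxK EU)).
by move/(can_inj (mulKVmx EU)); apply: horner_qpoly_inj.
Qed.

Lemma det_horner_adjoint (a : {poly %/ h}) : \det (horner_mx T a) = qnorm a.
Proof.
have [E EU hT] := adjoint_similar.
rewrite hT !det_mulmx mulrAC -det_mulmx mulVmx // det1 mul1r.
by rewrite (qnormE hm sh).
Qed.

Lemma act_adjoint X : X^T *m A = A *m X -> X *m T = T *m X -> X *m X = 1%:M ->
  act X v = v.
Proof.
move: (T) vec2E => T0; rewrite /act; case: (v) => A0 B0 /= BE XA XT XX.
congr (_, _); first by rewrite XA -mulmxA XX mulmx1.
by rewrite {1}BE mulmxA XA -!mulmxA -XT (mulmxA X) XX mul1mx -BE.
Qed.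

(** With B = A T, invariance gives X^T A T X = A T = X^T A X T, and X^T A can be cancelled. *)
Lemma act_comm_adjoint X : X \in unitmx -> act X v = v -> X *m T = T *m X.
Proof.
move=> XU; have XtU : X^T \in unitmx by rewrite unitmx_tr.
move: (T) vec2E unit_vec1 => T0; rewrite /act; case: (v) => A0 B0 /= -> AU [E1 E2].
apply: (can_inj (mulKmx AU)); apply: (can_inj (mulKmx XtU)).
by rewrite !mulmxA E1 -(mulmxA _ A0) E2.
Qed.

(** Such an [X] is skew-adjoint for [A], and then commutes with [T] by the second equation. So it is
    a polynomial in [T], hence self-adjoint as well, and 2 A X = 0. *)
Lemma lie_stab0 : 2%:R != 0 :> K -> lie_stab v = [set 0].
Proof.
move=> two; apply/seteqP; split=> X /=; last first.
  by move=> ->; split; rewrite ?mxtrace0 ?trmx0 ?mul0mx ?mulmx0 ?addr0.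
move=> [_ XA XB].
have XA' : X^T *m A = - (A *m X) by apply/eqP; rewrite -addr_eq0 XA.
have XT : X *m T = T *m X.
  move: XB; rewrite vec2E mulmxA XA' mulNmx -!mulmxA => /eqP.
  by rewrite addrC subr_eq0 => /eqP/(can_inj (mulKmx unit_vec1)).
have [a aE] := comm_adjoint XT; have := horner_adjoint a; rewrite -aE => XA2.
move: XA; rewrite XA2 -mulr2n -scaler_nat => /eqP.
rewrite scaler_eq0 (negPf two) /= => /eqP AX.
by rewrite -[X](mulKmx unit_vec1) AX mulmx0.
Qed.

Local Notation QM := (modpm 'M[K]_n).
Local Notation QL := (modpm {poly %/ h}).

Definition stab_iso (x : QL) : QM := (\pi_QM (horner_mx T (repr x : {poly %/ h})))%qT.

Lemma stab_isoE (a : {poly %/ h}) :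
  stab_iso (\pi_QL a)%qT = (\pi_QM (horner_mx T a))%qT.
Proof.
rewrite /stab_iso; case: (pm_reprP a) => -> //.
by apply/eqP/pm_piP; right; rewrite raddfN /= opprK.
Qed.

(** A stabilizing matrix commutes with [T], so it is some a(T), which is self-adjoint: X^T A X = A
    then reads a(T)^2 = 1. Its determinant is N(a), and signs correspond on both sides. *)
Lemma stab_iso_bij : set_bij (Rmu2 h) (hstab v) stab_iso.
Proof.
split.
- move=> _ [a [a2 Na] <-]; rewrite /= stab_isoE; split.
    by exists (horner_mx T a) => //=; rewrite det_horner_adjoint.
  rewrite hactE; apply: act_adjoint; first exact: horner_adjoint.
    exact: comm_horner_mx.
  by rewrite -(horner_qpolyM hm sh cT) -expr2 a2 (horner_qpoly1 hm sh cT).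
- move=> x y /set_mem[a _ <-] /set_mem[b _ <-]; rewrite !stab_isoE.
  move=> /eqP/pm_piP ab; apply/eqP/pm_piP.
  case: ab => [/horner_adjoint_inj|E]; first by left.
  by right; apply: horner_adjoint_inj; rewrite raddfN.
- move=> _ [[X /= dX <-]]; rewrite hactE => Xv.
  have XU : X \in unitmx by rewrite unitmxE dX unitr1.
  have [a aE] := comm_adjoint (act_comm_adjoint XU Xv).
  exists (\pi_QL a)%qT; last by rewrite stab_isoE aE.
  exists a => //; split; last by rewrite -det_horner_adjoint -aE.
  apply: horner_adjoint_inj.
  rewrite expr2 (horner_qpolyM hm sh cT) (horner_qpoly1 hm sh cT) -aE.
  have := congr1 fst Xv.
  rewrite /= aE horner_adjoint -aE -mulmxA => E1.
  by apply: (can_inj (mulKmx unit_vec1)); rewrite E1 mulmx1.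
Qed.

Lemma stab_isoM x y : Rmu2 h x -> Rmu2 h y ->
  stab_iso (rmul h x y) = hmul (stab_iso x) (stab_iso y).
Proof.
move=> [a _ <-] [b _ <-].
by rewrite rmulE !stab_isoE hmulE (horner_qpolyM hm sh cT).
Qed.

(** Comparing u^T s(B) u = B with u^T s(A) u = A gives T = u^-1 s(T) u, while [s] takes a(T) to s(a)
    evaluated at s(T). *)
Lemma stab_iso_gal (s : {rmorphism K -> K}) y x : SLmu2 K n y ->
  hact y (map_V s v) = v -> Rmu2 h x ->
  stab_iso (rgal h s x) = hmul (hmul (hinv y) (hgal s (stab_iso x))) y.
Proof.
move=> [u /= du <-]; rewrite hactE => uv [a _ <-].
have uU : u \in unitmx by rewrite unitmxE du unitr1.
have utU : u^T \in unitmx by rewrite unitmx_tr.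
rewrite rgalE !stab_isoE hgalE hinvE !hmulE.
rewrite (horner_in_qpoly hm sh cT) map_horner_mx -horner_mx_uconjC //.
congr (\pi_QM (horner_mx _ _))%qT.
have [uA uB] : u^T *m map_mx s A *m u = A /\ u^T *m map_mx s B *m u = B.
  by case: (v) uv => A0 B0 [].
apply: (can_inj (mulKmx unit_vec1)); rewrite -vec2E -[X in X *m _]uA -[LHS]uB.
rewrite -!mulmxA mulKVmx //; congr (_ *m _).
by rewrite mulmxA -map_mxM -vec2E.
Qed.

End Stabilizer.

(** * Order of the stabilizer and separability of g *)

Lemma separable_split (k ks : fieldType) (iota : {rmorphism k -> ks})
    (p : {poly ks}) : is_separable_closure iota -> p \is monic ->
  separable_poly p ->
  exists2 rs : seq ks, p = \prod_(r <- rs) ('X - r%:P) & uniq rs.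
Proof.
move=> hks pm psep.
suff [rs pE] : exists rs : seq ks, p = \prod_(r <- rs) ('X - r%:P).
  by exists rs => //; rewrite -separable_prod_XsubC -pE.
have [m] := ubnP (size p); elim: m p pm psep => // m IH p pm psep sp.
have [s1|s1] := ltnP 1 (size p); last first.
  have /size_poly1P[c _ pE] : size p == 1%N.
    by rewrite eqn_leq s1 size_poly_gt0 monic_neq0.
  exists [::]; rewrite big_nil.
  by move: pm; rewrite pE monicE lead_coefC => /eqP->.
have [r /factor_theorem[q pE]] := hks.2 p psep s1.
have qm : q \is monic by move: pm; rewrite pE monicMr ?monicXsubC.
have [||rs qE] := IH q qm.
- by apply: dvdp_separable psep; rewrite pE dvdp_mulr.
- by move: sp; rewrite pE size_Mmonic ?monicXsubC ?monic_neq0 // size_XsubC addn2.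
by exists (r :: rs); rewrite big_cons -qE mulrC.
Qed.

Lemma card_setT_finType (T : finType) : ([set: T] #= `I_#|T|)%card.
Proof.
apply: card_eq_trans (card_esym card_II).
have -> : [set: T] = (fun i : 'I_#|T| => enum_val i) @` setT.
  by apply/seteqP; split=> // x _; exists (enum_rank x); rewrite ?enum_rankK.
by apply: inj_card_eq => i l _ _; apply: enum_val_inj.
Qed.

Section CardRmu2.
Variables (K : fieldType) (m : nat) (h : {poly K}).
Local Notation n := m.+2.
Hypotheses (hm : h \is monic) (sh : size h = n.+1) (nev : ~~ odd m).
Variable r : 'I_n -> K.
Hypotheses (hr : h = \prod_(i < n) ('X - (r i)%:P)) (rI : injective r).
Hypothesis two : 2%:R != 0 :> K.
Local Notation QL := (modpm {poly %/ h}).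

Let mid (l : 'I_m) : 'I_n := lift ord0 (lift ord_max l).
Let top : 'I_n := lift ord0 ord_max.

Lemma prod_ord_ends (e : 'I_n -> K) :
  \prod_i e i = e ord0 * ((\prod_l e (mid l)) * e top).
Proof.
rewrite big_ord_recl big_ord_recr; congr (_ * (_ * _)); apply: eq_bigr => l _.
by congr (e (lift _ _)); apply: val_inj; rewrite /= /bump leqNgt ltn_ord.
Qed.

Lemma ord_endsP (P : 'I_n -> Prop) :
  P ord0 -> P top -> (forall l, P (mid l)) -> forall i, P i.
Proof.
move=> P0 Pt Pm i; case: (unliftP ord0 i) => [i' ->|->] //.
by case: (unliftP ord_max i') => [l ->|->]; [exact: Pm | exact: Pt].
Qed.

Lemma N1_neq1 : (-1 == 1 :> K) = false.
Proof.
apply/negbTE; apply: contra two => /eqP E; rewrite -[2%:R]/(1 + 1 : K).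
by rewrite -{1}E addNr.
Qed.

(* An element of square and norm 1 with value 1 at the first root is determined
   by its signs at the m middle roots, its value at the last root being forced. *)
Lemma card_Rmu2 : (Rmu2 h #= `I_(2 ^ m))%card.
Proof.
pose sg (e : {ffun 'I_m -> bool}) (l : 'I_m) : K := (-1) ^+ e l.
pose val e (i : 'I_n) : K := if unlift ord0 i is Some i' then
  if unlift ord_max i' is Some l then sg e l else \prod_l sg e l else 1.
have val0 e : val e ord0 = 1 by rewrite /val unlift_none.
have valt e : val e top = \prod_l sg e l by rewrite /val liftK unlift_none.
have valm e l : val e (mid l) = sg e l by rewrite /val !liftK.
have sg2 e l : sg e l ^+ 2 = 1 by rewrite /sg sqrr_sign.
have /choice[a aE] : forall e, exists a : {poly %/ h}, forall i, a.[r i] = val e i.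
  by move=> e; apply: qpoly_interp.
pose psi e := (\pi_QL (a e))%qT.
have psiI : {in [set: {ffun 'I_m -> bool}] &, injective psi}.
  move=> e e' _ _ /eqP/pm_piP[E|E].
    apply/ffunP => l; have := congr1 (fun q : {poly %/ h} => q.[r (mid l)]) E.
    rewrite /= !aE !valm /sg; case: (e l) (e' l) => [] [] //= /eqP.
      by rewrite eq_sym N1_neq1.
    by rewrite N1_neq1.
  have := congr1 (fun q : {poly %/ h} => q.[r ord0]) E.
  by rewrite /= hornerN !aE !val0 => /eqP; rewrite eq_sym N1_neq1.
have psiS : psi @` setT = Rmu2 h.
  apply/seteqP; split=> [_ [e _ <-]|_ [b [b2 Nb] <-]].
    exists (a e) => //; split.
      apply: (qpoly_eval_inj hm sh rI) => i.
      rewrite expr2 (eval_qpolyM hm sh hr) (eval_qpoly1 hm sh hr) aE -expr2.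
      elim/ord_endsP: i => [||l]; rewrite ?val0 ?valt ?valm ?expr1n ?sg2 //.
      by rewrite -prodrXl big1.
    rewrite (qnorm_prod hm sh hr rI) (eq_bigr _ (fun i _ => aE e i)).
    rewrite prod_ord_ends val0 mul1r valt (eq_bigr _ (fun l _ => valm e l)).
    by rewrite -expr2 -prodrXl big1.
  have ev2 (c : {poly %/ h}) i : c ^+ 2 = 1 -> c.[r i] ^+ 2 = 1.
    by move=> c2; rewrite expr2 -(eval_qpolyM hm sh hr) -expr2 c2 (eval_qpoly1 hm sh hr).
  suff main (c : {poly %/ h}) : c ^+ 2 = 1 -> qnorm c = 1 -> c.[r ord0] = 1 ->
      exists e, a e = c.
    have /eqP := ev2 b ord0 b2; rewrite sqrf_eq1 => /orP[]/eqP b0.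
      by have [e <-] := main _ b2 Nb b0; exists e.
    (* Passing to -b keeps the norm because n is even, and does not change the class of [b]. *)
    have [|||e eE] := main (- b).
    - by rewrite sqrrN.
    - rewrite (qnorm_prod hm sh hr rI).
      rewrite (eq_bigr (fun i => - b.[r i])); last by move=> i _; rewrite hornerN.
      rewrite prodrN cardT size_enum_ord -(qnorm_prod hm sh hr rI) Nb mulr1.
      by rewrite -signr_odd /= negbK (negPf nev).
    - by rewrite hornerN b0 opprK.
    exists e => //; apply/eqP/pm_piP; rewrite eE; right.
    by rewrite opprK.
  move=> c2 Nc c0; exists [ffun l => c.[r (mid l)] == -1].
  set e := finfun _.
  have cm l : c.[r (mid l)] = sg e l.
    rewrite /sg /e ffunE; have /eqP := ev2 c (mid l) c2.
    by rewrite sqrf_eq1 => /orP[]/eqP ->; rewrite ?eqxx // eq_sym N1_neq1.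
  apply: (qpoly_eval_inj hm sh rI) => i; rewrite aE.
  elim/ord_endsP: i => [||l]; rewrite ?val0 ?valt ?valm ?c0 ?cm //.
  move: Nc; rewrite (qnorm_prod hm sh hr rI) prod_ord_ends c0 mul1r.
  rewrite (eq_bigr _ (fun l _ => cm l)) => E.
  apply: (mulfI (_ : \prod_l sg e l != 0)); last by rewrite E -expr2 -prodrXl big1.
  by apply/prodf_neq0 => l _; rewrite signr_eq0.
rewrite -psiS; apply: card_eq_trans (inj_card_eq psiI) _.
have -> : (2 ^ m)%N = #|{ffun 'I_m -> bool}| by rewrite card_ffun card_bool card_ord.
exact: card_setT_finType.
Qed.

End CardRmu2.

(** A class is sent to everything equivalent to an [R]-partner of one of its members, so no
    representative is chosen. That [R] matches the two equivalences gives independence of the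
    partner and injectivity. *)
Lemma classes_bij (T U : Type) (P : set T) (Q : set U) (E1 : T -> T -> Prop)
    (E2 : U -> U -> Prop) (R : T -> U -> Prop) :
  (forall u, E1 u u) -> (forall u v, E1 u v -> E1 v u) ->
  (forall u v w, E1 u v -> E1 v w -> E1 u w) ->
  (forall u, E2 u u) -> (forall u v, E2 u v -> E2 v u) ->
  (forall u v w, E2 u v -> E2 v w -> E2 u w) ->
  (forall v, P v -> exists2 u, Q u & R v u) ->
  (forall u, Q u -> exists2 v, P v & R v u) ->
  (forall v w u z, Q u -> Q z -> R v u -> R w z -> (E1 v w <-> E2 u z)) ->
  exists F, set_bij [set [set w | E1 v w] | v in P]
                    [set [set w | Q w /\ E2 u w] | u in Q] F.
Proof.
move=> r1 s1 t1 r2 s2 t2 PQ QP RE.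
pose F (S : set T) : set U :=
  [set z | Q z /\ exists v u, [/\ S v, Q u, R v u & E2 u z]].
have FE v u : Q u -> R v u -> F [set w | E1 v w] = [set w | Q w /\ E2 u w].
  move=> Qu Rvu; apply/seteqP; split=> z /= [Qz].
    move=> [w [y [Evw Qy Rwy Eyz]]]; split=> //; apply: t2 Eyz.
    exact/(RE v w u y).
  by move=> Euz; split=> //; exists v, u; split=> //; apply: r1.
exists F; split.
- move=> _ [v Pv <-]; have [u Qu Rvu] := PQ v Pv.
  by exists u => //; rewrite (FE _ u).
- move=> _ _ /set_mem[v Pv <-] /set_mem[w Pw <-].
  have [u Qu Rvu] := PQ v Pv; have [z Qz Rwz] := PQ w Pw.
  rewrite (FE v u) // (FE w z) // => E.
  have [_ Euz] : [set y | Q y /\ E2 u y] z by rewrite E.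
  have Evw : E1 v w by apply/(RE v w u z).
  apply/seteqP; split=> y /= H; first exact: t1 (s1 _ _ Evw) H.
  exact: t1 Evw H.
- move=> _ [u Qu <-]; have [v Pv Rvu] := QP u Qu.
  by exists [set w | E1 v w]; [exists v | rewrite (FE v u)].
Qed.

Section PairEquiv.
Variables (k : fieldType) (n' : nat) (g : {poly k}).
Local Notation n := n'.+1.
Hypotheses (hg : g \is monic) (sg : size g = n.+1).

Lemma pair_equiv_refl (u : {poly %/ g} * k) : pair_equiv n u u.
Proof.
exists 1, 1; split; rewrite ?unitr1 ?oner_neq0 ?expr1n ?mul1r ?scale1r //.
by rewrite (qnorm1 hg sg) mulr1 mul1r.
Qed.

Lemma pair_equiv_sym (u w : {poly %/ g} * k) :
  pair_equiv n u w -> pair_equiv n w u.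
Proof.
case: u w => [a t] [b x] [c [d [/= cU dN0 <- <-]]].
exists c^-1, d^-1; split; rewrite ?unitrV ?invr_eq0 //.
  by rewrite -scalerAr scalerA mulVf // scale1r exprVn mulKr ?unitrX.
have NcN0 : qnorm c != 0 by rewrite -(qpoly_unitE hg sg).
have -> : qnorm c^-1 = (qnorm c)^-1.
  by apply: (mulfI NcN0); rewrite -(qnormM hg sg) mulrV // (qnorm1 hg sg) divff.
by rewrite exprVn -invfM mulKf // mulf_neq0 ?expf_neq0.
Qed.

Lemma pair_equiv_trans (u v w : {poly %/ g} * k) :
  pair_equiv n u v -> pair_equiv n v w -> pair_equiv n u w.
Proof.
case: u v w => [a t] [a' t'] [a2 t2] [c [d [/= cU dN0 <- <-]]].
move=> [c' [d' [/= cU' dN0' <- <-]]].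
exists (c * c'), (d * d'); split; rewrite ?unitrM ?cU ?cU' ?mulf_neq0 //=.
  by rewrite -scalerAr scalerA exprMn [X in _ = _ *: X]mulrA.
by rewrite (qnormM hg sg) exprMn [X in X * t2]mulrACA -[LHS]mulrA.
Qed.

End PairEquiv.

(** * Dehomogenized forms and the discriminant *)

Lemma dehom_map (k K : fieldType) (j : {rmorphism k -> K}) n (f : 'I_n.+1 -> k) :
  dehom (j \o f) = map_poly j (dehom f).
Proof.
rewrite /dehom /beval rmorph_sum; apply: eq_bigr => i _.
by rewrite !rmorphM !rmorphXn /= map_polyC map_polyX /= rmorph1.
Qed.

Lemma size_dehom (k : fieldType) n (f : 'I_n.+1 -> k) :
  f ord0 != 0 -> size (dehom f) = n.+1.
Proof.
move=> f0; pose E i := f (rev_ord (inord i)).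
have -> : dehom f = \poly_(i < n.+1) E i.
  rewrite poly_def /dehom /beval (reindex_inj rev_ord_inj) /=.
  apply: eq_bigr => i _; rewrite expr1n mulr1 mul_polyC subSS.
  rewrite subKn; last by rewrite -ltnS.
  by rewrite /E inord_val.
rewrite size_poly_eq // /E.
by have -> : rev_ord (inord n) = ord0 :> 'I_n.+1
  by apply: val_inj; rewrite /= inordK // subnn.
Qed.

(** f_0 maps to the product of the a_i, so all roots b_i / a_i are finite; two equal ones would make
    a factor of [D] vanish. *)
Lemma Delta_separable (k K : fieldType) (j : {rmorphism k -> K}) n
    (f : 'I_n.+1 -> k) (D : K) :
  is_Delta j f D -> D != 0 -> f ord0 != 0 -> separable_poly (dehom f).
Proof.
move=> [a [b [fE ->]]] DN0 f0; rewrite -(separable_map j) -dehom_map.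
(* This is the substitution y = c, used with c = 0 to obtain f_0 and with c = 1 to obtain the
   dehomogenized form. *)
have eval c : exists rho : {rmorphism {poly {poly K}} -> {poly K}},
    [/\ forall x, rho x%:P%:P = x%:P, rho 'X = 'X & rho 'Y = c%:P].
  exists (map_poly (horner_eval c)); split=> [x||].
  - by rewrite /= map_polyC /= /horner_eval hornerC.
  - by rewrite /= map_polyX.
  - by rewrite /= map_polyC /= /horner_eval hornerX.
have evalE c : beval (fun i => ((j \o f) i)%:P) 'X c%:P =
    \prod_(i < n) ((a i)%:P * 'X - (b i * c)%:P).
  have [rho [rC rX rY]] := eval c; have := congr1 rho fE.
  rewrite (rmorph_bform rho) rX rY rmorph_prod => E.
  rewrite /beval in E *; under eq_bigr do rewrite -rC; rewrite E.
  by apply: eq_bigr => i _; rewrite rmorphB !rmorphM rX rY !rC.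
have aN0 i : a i != 0.
  have : \prod_(i < n) a i != 0.
    have := evalE 0; rewrite beval0r.
    under eq_bigr do rewrite mulr0 subr0.
    rewrite big_split /= prodr_const cardT size_enum_ord => /(mulIf _) E.
    rewrite -polyC_eq0 rmorph_prod -E ?expf_neq0 ?polyX_eq0 //.
    by rewrite polyC_eq0 fmorph_eq0.
  by move/prodf_neq0; apply.
have -> : dehom (j \o f) = (\prod_(i < n) a i) *:
    \prod_(r <- [seq b i / a i | i : 'I_n]) ('X - r%:P).
  rewrite /dehom -polyC1 evalE big_map big_enum -mul_polyC rmorph_prod -big_split.
  apply: eq_bigr => i _; rewrite /= mulrBr -polyCM mulr1.
  by rewrite mulrC [a i * _]mulrC divfK.
rewrite (eqp_separable (eqp_scale _ _)) ?separable_prod_XsubC; last first.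
  by apply/prodf_neq0.
rewrite map_inj_uniq ?enum_uniq // => i l E.
have ab : a i * b l - a l * b i = 0.
  move/eqP: E; rewrite eqr_div // => /eqP E.
  by rewrite [a i * _]mulrC -E mulrC subrr.
apply: contraNeq DN0; rewrite neq_ltn => /orP[] il; apply/eqP.
  by rewrite (bigD1 i) //= (bigD1 l) //= ab expr0n !mul0r.
by rewrite (bigD1 l) //= (bigD1 i) //= -opprB ab oppr0 expr0n !mul0r.
Qed.

Lemma pcharN2_natr2 (K : fieldType) : 2%N \notin [pchar K] -> 2%:R != 0 :> K.
Proof. by rewrite inE. Qed.

(** * Orbits and classes of pairs *)

Section OrbitsAndPairs.
Variables (k ks : fieldType) (iota : {rmorphism k -> ks}) (n' : nat).
Local Notation n := n'.+1.
Hypotheses (hk : 2%N \notin [pchar k]) (hks : is_separable_closure iota).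
Hypothesis hn : ~~ odd n.
Variables (f : 'I_n.+1 -> k) (g : {poly k}).
Hypotheses (hf0 : f ord0 != 0) (hg : g \is monic) (sg : size g = n.+1).
Hypotheses (hfg : dehom f = f ord0 *: g) (gsep : separable_poly g).

Lemma orbits_pairs_bij :
  exists F : set ('M[k]_n * 'M[k]_n) -> set ({poly %/ g} * k),
    set_bij (orbits iota f) (pair_classes g n (f ord0)) F.
Proof.
(* The roots of [g] in ks provide the splitting that the correspondence over k requires. *)
have [rs gE rsU] : exists2 rs : seq ks,
    map_poly iota g = \prod_(r <- rs) ('X - r%:P) & uniq rs.
  by apply: (separable_split hks); rewrite ?monic_map ?separable_map.
have -> : orbits iota f = [set [set w | rat_act v w] | v in Vf f].
  apply: eq_imagel => v _; apply/seteqP.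
  by split=> w /(orbitP hk hks v w (ltn0Sn _) hn).
apply: (@classes_bij _ _ (Vf f) (pairs g (f ord0)) (@rat_act k n) (@pair_equiv k g n)
          (normal_form (f ord0))).
- exact: rat_act_refl.
- exact: rat_act_sym.
- exact: rat_act_trans.
- exact: pair_equiv_refl.
- exact: pair_equiv_sym.
- exact: pair_equiv_trans.
- move=> v /(VfP _ hf0 hfg); exact: (normal_form_exists hg sg gE rsU hf0).
- move=> u /(vec_exists hg sg hf0)[v vP vu]; exists v => //.
  exact/(VfP _ hf0 hfg).
- move=> v w u z [uU _ _] [zU _ _] vu wz; split.
    move=> /(normal_form_equiv hg sg vu wz uU).
    exact: pair_equiv_sym.
  move=> /(pair_equiv_sym hg sg)[c [d [cU dN0 aE tE]]].
  have [G [dG GA GB]] := normal_form_transport hg sg hf0 vu wz aE tE.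
  by exists d, G.
Qed.

End OrbitsAndPairs.

(** * The descended stabilizer *)

Section SplitStabilizer.
Variables (k ks : fieldType) (iota : {rmorphism k -> ks}) (m : nat).
Local Notation n := m.+2.
Hypotheses (hk : 2%N \notin [pchar k]) (hks : is_separable_closure iota).
Variables (f : 'I_n.+1 -> k) (p : {poly ks}).
Hypotheses (hf0 : f ord0 != 0) (hp : p \is monic) (sp : size p = n.+1).
Hypotheses (hfp : dehom (iota \o f) = iota (f ord0) *: p).
Hypothesis psep : separable_poly p.
Local Notation f0 := ((iota \o f) ord0).

Lemma roots_ord : exists2 r : 'I_n -> ks,
  p = \prod_(i < n) ('X - (r i)%:P) & injective r.
Proof.
have [rs pE rsU] := separable_split hks hp psep.
have srs : size rs = n.
  by apply: succn_inj; rewrite -sp pE size_prod_XsubC.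
exists (fun i => nth 0 rs i); first by rewrite {1}pE (big_nth 0) srs big_mkord.
move=> i l /eqP; rewrite nth_uniq ?srs // => /eqP; exact: val_inj.
Qed.

Lemma descended_stabilizer :
  is_descended_stabilizer iota f (Rmu2 p) (rmul p) (rgal p).
Proof.
have [rs pE rsU] := separable_split hks hp psep.
(* Over ks the polynomial [p] already splits, so the correspondence is used with the identity as
   extension. *)
have pE' : map_poly idfun p = \prod_(r <- rs) ('X - r%:P) by rewrite map_poly_id.
have [r pr rI] := roots_ord.
have fN0 : f0 != 0 by rewrite fmorph_eq0.
have vecP v := VfP v fN0 hfp.
have sqrt := ks_sqrt hk hks.
have two : 2%:R != 0 :> ks by apply: pcharN2_natr2; rewrite (fmorph_pchar iota).
split.
(* The pair (1, t) with t^2 = f_0 comes from a vector. *)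
- have [t tE] := sqrt f0.
  have tN0 : t != 0 by apply: contraNneq fN0 => t0; rewrite -tE t0 expr0n.
  have [|v vP _] := @vec_exists ks m.+1 p hp sp f0 fN0 (1, t).
    by split=> //=; rewrite ?unitr1 // (qnorm1 hp sp) mulr1.
  by exists v; apply/vecP.
- move=> v w /vecP vP /vecP wP.
  have [u [uU _ uE] vu] := normal_form_exists hp sp pE' rsU fN0 vP.
  have [z [zU zN0 zE] wz] := normal_form_exists hp sp pE' rsU fN0 wP.
  (* The first components differ by a square in the split algebra. Then N(c) u.2 is z.2 up to sign,
     and the element [e] of norm -1 corrects the sign without changing c^2. *)
  have [c cE] := qpoly_sqrt hp sp pr rI (z.1 / u.1) sqrt.
  have zc : c ^+ 2 * u.1 = z.1 by rewrite cE divrK.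
  have [e e2 Ne] := qpoly_norm_N1 hp sp pr rI.
  have : (qnorm c * u.2) ^+ 2 = z.2 ^+ 2.
    rewrite exprMn -zE -zc (qnormM hp sp) [c ^+ 2]expr2 (qnormM hp sp) -uE.
    by rewrite -expr2 mulrCA.
  move/eqP; rewrite eqf_sqr => Nc.
  have [c' c'u c'N] : exists2 c', c' ^+ 2 * u.1 = z.1 & qnorm c' * u.2 = z.2.
    case/orP: Nc => /eqP Nc; [by exists c | exists (e * c)].
      by rewrite exprMn e2 mul1r.
    by rewrite (qnormM hp sp) Ne mulN1r mulNr Nc opprK.
  have [||G [dG GA GB]] :=
    @normal_form_transport _ _ _ hp sp f0 fN0 v w u z c' 1 vu wz.
  - by rewrite scale1r.
  - by rewrite expr1n mulr1.
  exists (\pi_(modpm 'M[ks]_n) G)%qT.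
    by exists G => //=; move: dG; rewrite expr1n mul1r.
  rewrite hactE; move: GA GB; rewrite !scale1r.
  by case: (w) => A B /= <- <-.
- by move=> v /vecP vP; apply: (lie_stab0 hp sp pE' rsU fN0 vP).
- move=> v /vecP vP; exists (stab_iso v); split.
  + exact: (stab_iso_bij hp sp pE' rsU fN0 vP).
  + exact: (stab_isoM hp sp fN0 vP).
  + by move=> s y x _; apply: (stab_iso_gal hp sp fN0 vP).
Qed.

End SplitStabilizer.

Unset Implicit Arguments.

Theorem theorem4p3 (k : fieldType) (hk : 2%N \notin [pchar k])
  (ks : fieldType) (iota : {rmorphism k -> ks})
  (hks : is_separable_closure iota)
  (kbar : closedFieldType) (j : {rmorphism k -> kbar})
  (hkbar : is_algebraic_closure j)
  (n : nat) (hn0 : (0 < n)%N) (hn : ~~ odd n)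
  (f : 'I_n.+1 -> k)
  (Delta : kbar) (hDelta : is_Delta j f Delta) (hDelta0 : Delta != 0)
  (hf0 : f ord0 != 0)
  (g : {poly k}) (hg : g \is monic) (hfg : dehom f = f ord0 *: g) :
  (exists F : set ('M[k]_n * 'M[k]_n) -> set ({poly %/ g} * k),
     set_bij (orbits iota f) (pair_classes g n (f ord0)) F) /\
  [/\ is_descended_stabilizer iota f (Rmu2 (map_poly iota g))
        (rmul (map_poly iota g)) (rgal (map_poly iota g)),
      (forall x y, Rmu2 (map_poly iota g) x -> Rmu2 (map_poly iota g) y ->
         rmul (map_poly iota g) x y = rmul (map_poly iota g) y x) &
      (Rmu2 (map_poly iota g) #= `I_(2 ^ (n - 2)))%card].
Proof.
have gsep : separable_poly g.
  rewrite -(eqp_separable (eqp_scale g hf0)) -hfg.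
  exact: Delta_separable hDelta hDelta0 hf0.
have sg : size g = n.+1 by rewrite -(size_scale g hf0) -hfg size_dehom.
(* [n] is positive and even, so it is m + 2 and the order is 2^m. *)
case: n => [|[|m]] // in hn0 hn f hDelta hf0 hfg sg *.
split; first exact: orbits_pairs_bij.
set p := map_poly iota g.
have hp : p \is monic by rewrite monic_map.
have sp : size p = m.+3 by rewrite size_map_poly.
have psep : separable_poly p by rewrite separable_map.
have hfp : dehom (iota \o f) = iota (f ord0) *: p.
  by rewrite dehom_map hfg map_polyZ.
split; first exact: descended_stabilizer.
- by move=> x y [a _ <-] [b _ <-]; rewrite !rmulE mulrC.
- have [r pr rI] := roots_ord hks hp sp psep.
  rewrite subn2; apply: (card_Rmu2 hp sp _ pr rI); last first.
    by apply: pcharN2_natr2; rewrite (fmorph_pchar iota).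
  by move: hn; rewrite /= negbK.
Qed.
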